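(* Let $\mathfrak s$ be a symmetry jet on a manifold $M$, let $\nabla=\nabla^{\mathfrak s}$ be the associated affine connection, with torsion $T^\nabla$, and let $S$ be its affine extension map. Let $\xi\in\mathcal B^{(1)}$ with $\alpha(\xi)=x$, and let $\mathcal X\in T^2M$ with $p(\mathcal X)=Y_x\in T_xM$ and $p_*(\mathcal X)=X_x\in T_xM$. Then $$\pi\bigl(S(\xi)\cdot\mathcal X,\;\kappa(S(\xi))\cdot\mathcal X\bigr)=\xi\bigl(T^\nabla(X_x,Y_x)\bigr)-T^\nabla\bigl(\xi(X_x),\xi(Y_x)\bigr).$$ In particular, the affine $(1,1)$-jet $S(\xi)$ extending $\xi$ is a $2$-jet if and only if $\xi$ preserves the torsion.
   Context: All objects are smooth. $\mathcal B^{(1)}$ is the Lie groupoid over $M$ of linear isomorphisms $\xi:T_xM\to T_yM$, source $\alpha(\xi)=x$, target $\beta(\xi)=y$; $-I_x=-\mathrm{id}_{T_xM}$. A local bisection of $\mathcal B^{(1)}$ is a section $b:U\to\mathcal B^{(1)}$ of $\alpha$ over an open $U$ with $b^0:=\beta\circ b$ a diffeomorphism onto an open set. A $(1,1)$-jet is the $1$-jet $j^1_xb$ of such a $b$; $p(j^1_xb)=b(x)$, $p_*(j^1_xb)=(b^0)_{*_x}$; $\mathcal B^{(1,1)}_{sh}$ is the set of those with $p=p_*$. A $2$-jet $j^2_xf$ of a local diffeomorphism is identified with the $(1,1)$-jet $j^1_x(x'\mapsto f_{*_{x'}})$. A symmetry jet is a smooth section $\mathfrak s:M\to\mathcal B^{(1,1)}_{sh}$,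 $\mathfrak s(x)$ being a jet at $x$ with $p(\mathfrak s(x))=-I_x$. With $(bY)_{b^0(x')}=b(x')Y_{x'}$, the associated connection is $(\nabla^{\mathfrak s}_XY)_x=\frac12[X,Y+s_xY]_x$ where $\mathfrak s(x)=j^1_xs_x$. Each $\xi\in\mathcal B^{(1)}$ with $\alpha(\xi)=x$ has a unique extension $S(\xi)=j^1_xa\in\mathcal B^{(1,1)}_{sh}$ with $p(S(\xi))=\xi$ which is affine: $\xi(\nabla_{X_x}Y)=\nabla_{\xi X_x}(aY)$ for all $X_x\in T_xM$ and vector fields $Y$. Second tangent bundle: a chart of $M$ induces coordinates $(x,X,Y,V)$ on $T^2M=T(TM)$, the point being the vector with components $(Y,V)$ at $(x,X)\in TM$. Then $p(x,X,Y,V)=(x,X)$ is the canonical projection $T(TM)\to TM$, $p_*(x,X,Y,V)=(x,Y)$ is the differential of $TM\to M$, and $\kappa(x,X,Y,V)=(x,Y,X,V)$ is the canonical involution. If $\mathcal X_1=(x,X,Y,V_1)$, $\mathcal X_2=(x,X,Y,V_2)$ have the same images under $p$ and $p_*$, $\pi(\mathcal X_1,\mathcal X_2)\in T_xM$ is the (chart-independent) vector with components $V_1-V_2$. A $(1,1)$-jet $j^1_xb$ acts on $T^2M$ over $x$ by $j^1_xb\cdot\frac{dX_t}{dt}|_{0}=\frac{d}{dt}\bigl(b(x_t)X_t\bigr)|_{0}$, where $X_t\in T_{x_t}M$, $x_0=x$. For $\eta\in\mathcal B^{(1,1)}_{sh}$, $\kappa(\eta)\in\mathcal B^{(1,1)}_{sh}$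 is determined by $\kappa(\eta)\cdot\mathcal X=\kappa(\eta\cdot\kappa(\mathcal X))$. Torsion: $T^\nabla(X,Y)=\nabla_XY-\nabla_YX-[X,Y]$; $\xi$ preserves $T^\nabla$ if $T^\nabla(\xi X_x,\xi Y_x)=\xi T^\nabla(X_x,Y_x)$ for all $X_x,Y_x\in T_xM$. *)

(* Defs.v *)
From HB Require Import structures.
From mathcomp Require Import all_boot all_order all_algebra.
From mathcomp Require Import all_classical all_reals all_analysis.

Set Implicit Arguments.
Unset Strict Implicit.
Unset Printing Implicit Defensive.

Import Order.TTheory GRing.Theory Num.Theory.
Import numFieldNormedType.Exports.

Local Open Scope classical_set_scope.
Local Open Scope ring_scope.

(* All partially defined objects below (inverse charts, differentials,
   brackets, jet actions, ...) are selected from their defining property with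
   [xget default property]; the default is only taken when nothing satisfies
   the property. *)

Section Smoothness.
Context {R : realType} {E F : normedModType R}.

(* For finite-dimensional E this is the usual C^k: f is differentiable and all
   the u |-> 'd f u v are C^(k-1). *)
Fixpoint Ck (k : nat) (U : set E) (f : E -> F) : Prop :=
  if k is k'.+1 then
    (forall u, U u -> differentiable f u) /\
    (forall v, Ck k' U (fun u => 'd f u v))
  else forall u, U u -> {for u, continuous f}.

Definition smooth_near (f : E -> F) (u : E) : Prop :=
  exists2 U : set E, open_nbhs u U & forall k, Ck k U f.

End Smoothness.

(* An atlas on T with values in E: [coord c] is only meaningful on [dom c].
   No axiom is imposed here, so that the induced atlases on tangent bundles
   and jet bundles are plain definitions; see [smooth_manifold]. *)
Record charted (R : realType) (E : normedModType R) (T : choiceType) := Charted {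
  chart : Type;
  dom : chart -> set T;
  coord : chart -> T -> E }.

Section Charted.
Context {R : realType} {E : normedModType R} {T : choiceType} (A : charted E T).

(* inverse of the chart c; the base point x is a default value *)
Definition inv_coord (c : chart A) (x : T) (u : E) : T :=
  xget x [set x' | dom c x' /\ coord c x' = u].

(* A tangent vector at x is its family of components in the charts at x,
   related by the differentials of the transition maps; components in the
   other charts are set to 0. *)
Definition tangent_family (x : T) : {pred (chart A -> E)} :=
  fun v => `[< (forall c, ~ dom c x -> v c = 0) /\
    (forall c d, dom c x -> dom d x ->
       v d = 'd (coord d \o inv_coord c x) (coord c x) (v c)) >].

Lemma tangent_family_submod x : submod_closed (tangent_family x).
Proof.
split=> [|a u v /asboolP[u0 uE] /asboolP[v0 vE]].
  apply/asboolP; split=> // c d _ _.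
  have -> : (0 : chart A -> E) c = 0 by [].
  by rewrite linear0.
apply/asboolP; split=> [c cx|c d cx dx].
  rewrite -[LHS]/(a *: u c + v c).
  by rewrite u0// v0// scaler0 addr0.
rewrite -[LHS]/(a *: u d + v d) -[X in 'd _ _ X]/(a *: u c + v c).
by rewrite linearP (uE c)// (vE c).
Qed.

HB.instance Definition _ x :=
  GRing.isSubmodClosed.Build R (chart A -> E) (tangent_family x)
    (tangent_family_submod x).

Record tangent (x : T) := Tangent {
  tcoord :> chart A -> E;
  _ : tcoord \in tangent_family x }.

HB.instance Definition _ x := [isSub for @tcoord x].
HB.instance Definition _ x := [Choice of tangent x by <:].
HB.instance Definition _ x := [SubChoice_isSubLmodule of tangent x by <:].

(* chart-induced coordinates (x, X) on the tangent bundle *)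
Definition tangent_bundle : charted (E * E)%type {x : T & tangent x} :=
  @Charted R (E * E)%type {x : T & tangent x} (chart A)
    (fun c z => dom c (tag z))
    (fun c z => (coord c (tag z), tagged z c)).

End Charted.

Definition self_charted (R : realType) (E : normedModType R) : charted E E :=
  @Charted R E E unit (fun _ => setT) (fun _ u => u).

Section Maps.
Context {R : realType} {E F : normedModType R} {T S : choiceType}.
Variables (A : charted E T) (B : charted F S).

Definition local_expr (f : T -> S) (x : T) (c : chart A) (d : chart B) : E -> F :=
  fun u => coord d (f (inv_coord c x u)).

(* f is smooth on a neighbourhood of x *)
Definition smooth_at (f : T -> S) (x : T) : Prop :=
  exists (c : chart A) (d : chart B),
    [/\ dom c x, dom d (f x),
        \forall u \near coord c x, dom d (f (inv_coord c x u)) &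
        smooth_near (local_expr f x c d) (coord c x)].

Definition tdiff (f : T -> S) (x : T) (v : tangent A x) : tangent B (f x) :=
  xget 0 [set w : tangent B (f x) | forall c d, dom c x -> dom d (f x) ->
    w d = 'd (local_expr f x c d) (coord c x) (v c)].

Definition same_jet1 (f g : T -> S) (x : T) : Prop :=
  f x = g x /\
  forall c d, dom c x -> dom d (f x) ->
    'd (local_expr f x c d) (coord c x) =1 'd (local_expr g x c d) (coord c x).

End Maps.

Arguments tdiff {R E F T S} A B f {x} v.

(* dg/dt at t = 0 *)
Definition velocity (R : realType) (E : normedModType R) (T : choiceType)
    (A : charted E T) (g : R^o -> T) : {x : T & tangent A x} :=
  existT (tangent A) (g 0)
    (xget 0 [set w : tangent A (g 0) | forall c, dom c (g 0) ->
       w c = derive1 (fun t : R => coord c (g t)) 0]).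

Definition smooth_manifold (R : realType) (n : nat) (M : topologicalType)
    (A : charted 'rV[R]_n M) : Prop :=
  [/\ hausdorff_space M, @second_countable M,
      (forall x : M, exists c : chart A, dom c x),
      (forall c : chart A,
        [/\ open (dom c), {in dom c &, injective (coord c)},
            (forall x, dom c x -> {for x, continuous (coord c)}) &
            (forall V : set M, open V -> V `<=` dom c -> open (coord c @` V))]) &
      (forall (c d : chart A) (x : M), dom c x -> dom d x ->
        smooth_near (coord d \o inv_coord c x) (coord c x))].

Section FrameGroupoid.
Context {R : realType} {n : nat} {M : topologicalType}.
Variable A : charted 'rV[R]_n M.

Record tiso (x y : M) := TIso {
  iso_fun :> {linear tangent A x -> tangent A y};
  iso_bij : bijective iso_fun }.

HB.instance Definition _ x y := gen_eqMixin (tiso x y).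
HB.instance Definition _ x y := gen_choiceMixin (tiso x y).

Lemma opp_bij (x : M) : bijective (-%R : tangent A x -> tangent A x).
Proof. by exists -%R; exact: opprK. Qed.

(* -I_x *)
Definition neg_id (x : M) : tiso x x :=
  @TIso x x (-%R : {linear tangent A x -> tangent A x}) (opp_bij x).

(* the elements of B^(1) with source x: a section of the source map is a
   dependent function of type forall x, iso_from x *)
Definition iso_from (x : M) := {y : M & tiso x y}.
Definition B1 := {x : M & iso_from x}.

(* the tangent vector at x with components v in the chart c *)
Definition tvec (c : chart A) (x : M) (v : 'rV[R]_n) : tangent A x :=
  xget 0 [set w : tangent A x | w c = v].

Definition iso_mx (x y : M) (xi : tiso x y) (c d : chart A) : 'M[R]_n :=
  lin1_mx (fun v => xi (tvec c x v) d).

Definition B1_charted :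
    charted ('rV[R]_n * ('rV[R]_n * 'M[R]_n))%type (B1 : choiceType) :=
  @Charted R ('rV[R]_n * ('rV[R]_n * 'M[R]_n))%type B1 (chart A * chart A)%type
    (fun cd z => dom cd.1 (tag z) /\ dom cd.2 (tag (tagged z)))
    (fun cd z => (coord cd.1 (tag z),
                  (coord cd.2 (tag (tagged z)),
                   iso_mx (tagged (tagged z)) cd.1 cd.2))).

Definition local_diffeo (U : set M) (f : M -> M) : Prop :=
  [/\ open U, (forall x, U x -> smooth_at A A f x), open (f @` U) &
      exists g : M -> M,
        forall x, U x -> g (f x) = x /\ smooth_at A A g (f x)].

(* local bisections; the values of [bis_val] outside [bis_dom] are irrelevant *)
Record bisection := Bisection {
  bis_dom : set M;
  bis_val :> forall x : M, iso_from x;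
  bis_smooth : forall x, bis_dom x ->
    smooth_at A B1_charted (fun x' => existT iso_from x' (bis_val x')) x;
  bis_diffeo : local_diffeo bis_dom (fun x => tag (bis_val x)) }.

Definition bis_pt (b : bisection) (x : M) : B1 := existT iso_from x (b x).
(* b^0 *)
Definition bis0 (b : bisection) (x : M) : M := tag (b x).

(* j^1_x b, as an equivalence class of local bisections defined at x *)
Definition j1 (x : M) (b : bisection) : set bisection :=
  [set b' | bis_dom b' x /\ same_jet1 A B1_charted (bis_pt b) (bis_pt b') x].

Record jet11 (x : M) := Jet11 {
  jet_class :> set bisection;
  jet_class_ex : exists b, bis_dom b x /\ jet_class = j1 x b }.

HB.instance Definition _ x := gen_eqMixin (jet11 x).
HB.instance Definition _ x := gen_choiceMixin (jet11 x).

Section Jets.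
Context {x : M}.
Implicit Type eta : jet11 x.

Definition jet_rep eta : bisection := projT1 (cid (jet_class_ex eta)).

Definition jet_p eta : iso_from x := jet_rep eta x.

Definition jet_pstar eta : tangent A x -> tangent A (tag (jet_p eta)) :=
  fun v => tdiff A A (bis0 (jet_rep eta)) v.

Definition semiholonomic eta : Prop :=
  forall v : tangent A x, tagged (jet_p eta) v = jet_pstar eta v.

Definition is_2jet eta : Prop :=
  exists b : bisection, [/\ bis_dom b x, jet_class eta = j1 x b &
    forall x', bis_dom b x' ->
      forall v : tangent A x', tagged (b x') v = tdiff A A (bis0 b) v].

(* the components, in the charts c and d, of the derivative at x of
   x' |-> (b^0(x'), b(x')) *)
Definition jet_local eta (c d : chart A) : 'rV[R]_n -> 'rV[R]_n * 'M[R]_n :=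
  'd (fun u => (coord (c := B1_charted) (c, d)
                  (bis_pt (jet_rep eta) (inv_coord c x u))).2) (coord c x).

End Jets.

Definition B11 := {x : M & jet11 x}.

(* the derivative in [jet_local] is recorded by its two matrices *)
Definition B11_charted :
    charted (('rV[R]_n * ('rV[R]_n * 'M[R]_n)) * ('M[R]_n * 'M[R]_(n, n * n)))%type
      (B11 : choiceType) :=
  @Charted R (('rV[R]_n * ('rV[R]_n * 'M[R]_n)) * ('M[R]_n * 'M[R]_(n, n * n)))%type
    B11 (chart A * chart A)%type
    (fun cd z => dom cd.1 (tag z) /\ dom cd.2 (tag (jet_p (tagged z))))
    (fun cd z =>
       (coord (c := B1_charted) cd (existT iso_from (tag z) (jet_p (tagged z))),
        (lin1_mx (fun v => (jet_local (tagged z) cd.1 cd.2 v).1),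
         lin1_mx (fun v => mxvec (jet_local (tagged z) cd.1 cd.2 v).2)))).

Definition symmetry_jet (s : forall x : M, jet11 x) : Prop :=
  [/\ forall x, semiholonomic (s x),
      forall x, jet_p (s x) = existT (tiso x) x (neg_id x) &
      forall x, smooth_at A B11_charted (fun x' => existT jet11 x' (s x')) x].

End FrameGroupoid.

Section Connection.
Context {R : realType} {n : nat} {M : topologicalType}.
Context {A : charted 'rV[R]_n M}.
Local Notation TM := {x : M & tangent A x}.
Local Notation "'tpt' v" := (existT (tangent A) _ v) (at level 10).

(* A local vector field near x is a total section satisfying
   [smooth_vfield_at _ x]; its values away from x are irrelevant. *)
Definition vfield := forall x : M, tangent A x.
Implicit Types X Y : vfield.

Definition smooth_vfield_at X (x : M) : Prop :=
  smooth_at A (tangent_bundle A) (fun x' => tpt (X x')) x.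

Definition vder (x : M) (v : tangent A x) (f : M -> R^o) : R^o :=
  xget 0 [set r | forall c, dom c x ->
    r = 'd (f \o inv_coord c x) (coord c x) (v c)].

(* [X, Y] is the commutator of the derivations X and Y *)
Definition bracket X Y (x : M) : tangent A x :=
  xget 0 [set w : tangent A x | forall f : M -> R^o,
    smooth_at A (self_charted R^o) f x ->
    vder w f = vder (X x) (fun x' => vder (Y x') f)
             - vder (Y x) (fun x' => vder (X x') f)].

Definition bis_mul (b : bisection A) (z : TM) : TM :=
  existT (tangent A) (bis0 b (tag z)) (tagged (b (tag z)) (tagged z)).

(* the vector field bY, on b^0(U) *)
Definition push (b : bisection A) Y : vfield := fun y =>
  xget 0 [set w : tangent A y | exists2 x, bis_dom b x & tpt w = bis_mul b (tpt (Y x))].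

Variable s : forall x : M, jet11 A x.

Definition nabla X Y : vfield := fun x =>
  2^-1 *: bracket X (fun x' => Y x' + push (jet_rep (s x)) Y x') x.

Definition nabla_at (x : M) (v : tangent A x) Y : tangent A x :=
  xget 0 [set w : tangent A x | forall X, smooth_vfield_at X x -> X x = v ->
    w = nabla X Y x].

Definition torsion (x : M) (v w : tangent A x) : tangent A x :=
  xget 0 [set t : tangent A x | forall X Y, smooth_vfield_at X x -> smooth_vfield_at Y x ->
    X x = v -> Y x = w -> t = nabla X Y x - nabla Y X x - bracket X Y x].

Definition preserves_torsion (x y : M) (xi : tiso A x y) : Prop :=
  forall v w : tangent A x, torsion (xi v) (xi w) = xi (torsion v w).

Definition affine_extension (x y : M) (xi : tiso A x y) (eta : jet11 A x) : Prop :=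
  [/\ semiholonomic eta, jet_p eta = existT (tiso A x) y xi &
      forall (v : tangent A x) Y, smooth_vfield_at Y x ->
        xi (nabla_at v Y) = nabla_at (xi v) (push (jet_rep eta) Y)].

(* the affine extension map S *)
Definition affine_ext (x y : M) (xi : tiso A x y) : jet11 A x :=
  xget (s x) (affine_extension xi).

End Connection.

Section SecondTangent.
Context {R : realType} {n : nat} {M : topologicalType}.
Context {A : charted 'rV[R]_n M}.
Local Notation TM := {x : M & tangent A x}.
Local Notation T2M := {z : TM & tangent (tangent_bundle A) z}.

(* [t2coord c Z] is ((x, X), (Y, V)) *)
Definition t2coord (c : chart A) (Z : T2M) :=
  coord (c := tangent_bundle (tangent_bundle A)) c Z.

Definition t2_base (Z : T2M) : M := tag (tag Z).

Definition t2_p (Z : T2M) : TM := tag Z.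

Definition t2_pstar (Z : T2M) : TM :=
  existT (tangent A) (t2_base Z)
    (tdiff (tangent_bundle A) A (fun z : TM => tag z) (tagged Z)).

Definition t2_kappa (Z : T2M) : T2M :=
  xget Z [set Z' | t2_base Z' = t2_base Z /\
    forall c, dom c (t2_base Z) ->
      t2coord c Z' = ((coord c (t2_base Z), (t2coord c Z).2.1),
                      ((t2coord c Z).1.2, (t2coord c Z).2.2))].

(* only used when Z1 and Z2 have the same images under p and p_* *)
Definition t2_pi (Z1 Z2 : T2M) : TM :=
  existT (tangent A) (t2_base Z1)
    (xget 0 [set w : tangent A (t2_base Z1) | forall c, dom c (t2_base Z1) ->
       w c = (t2coord c Z1).2.2 - (t2coord c Z2).2.2]).

Definition jet_act (x : M) (eta : jet11 A x) (Z : T2M) : T2M :=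
  xget Z [set Z' | exists g : R^o -> TM,
    [/\ smooth_at (self_charted R^o) (tangent_bundle A) g 0,
        velocity (tangent_bundle A) g = Z &
        Z' = velocity (tangent_bundle A) (fun t => bis_mul (jet_rep eta) (g t))]].

Definition jet_kappa (x : M) (eta : jet11 A x) : jet11 A x :=
  xget eta [set eta' | semiholonomic eta' /\
    forall Z : T2M, t2_base Z = x ->
      jet_act eta' Z = t2_kappa (jet_act eta (t2_kappa Z))].

End SecondTangent.

(* Main.v *)
(* In charts [c] at [x] and [d] at [y], and with tangent vectors written as rows,
   a semiholonomic (1,1)-jet extending [xi] is a pair (B, Q): the matrix [B] of
   [xi] and a linear matrix-valued map [Q], the differential at [x] of the matrix
   of a representing bisection.  It acts on the second tangent bundle by
     (x, Y, X, V) |-> (y, Y B, X B, V B + Y Q(X)),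
   so that pi (eta . Z, kappa eta . Z) = Y Q(X) - X Q(Y), and eta is a 2-jet if
   and only if Q is symmetric: necessity is the symmetry of second derivatives,
   sufficiency an explicit construction.
   Let Q_x be the form [Q] of the symmetry jet at [x], for which B = -1. Computing
   the bracket in a chart gives
     nabla_X Y = DY(X) - 1/2 Y Q_x(X),   T(X, Y) = 1/2 (X Q_x(Y) - Y Q_x(X)),
   and eta is affine if and only if
     Q(X) = 1/2 (B Q_y(X B) - Q_x(X) B).
   Substituting this in Y Q(X) - X Q(Y) yields xi (T(X, Y)) - T(xi X, xi Y). *)

Require Import Defs.
From HB Require Import structures.
From mathcomp Require Import all_boot all_order all_algebra.
From mathcomp Require Import all_classical all_reals all_analysis.
From mathcomp Require Import perm ring lra.
(* [coord] is to denote the chart coordinates rather than [vector.coord]. *)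
Require Import Defs.

Set Implicit Arguments.
Unset Strict Implicit.
Unset Printing Implicit Defensive.

Import Order.TTheory GRing.Theory Num.Theory.
Import numFieldNormedType.Exports.

Local Open Scope classical_set_scope.
Local Open Scope ring_scope.

(** * Differential calculus *)

Section Differentials.
Context {R : realType}.

(** Most operations are selected by [xget] from a property quantified over all charts, test
    functions, curves or field extensions. A chart formula therefore needs a witness built in one
    chart together with its consistency everywhere else. For vectors consistency is the chain rule;
    for [kappa] and the bracket it is the symmetry of second derivatives. For S(xi) and its [kappa]
    the witness is a jet, so a local bisection with prescribed B and Q has to be constructed. Affine
    chart expressions suffice, because semiholonomy is a condition at one point only. A 2-jet needs
    a bisection whose matrix is the Jacobian of its base map on a whole neighbourhood, hence the
    nonlinear construction [cayley]. Since B = -1 for the symmetry jet, Y + s_x Y vanishes at x. The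
    bracket then involves no derivative of X and equals 2 DY(X) - Y Q_x(X), which the factor 1/2
    normalises. In the affine condition DY(X) B occurs on both sides and cancels; what remains is
    bilinear in the values at x and determines Q. *)

Lemma near_eq_is_diff (V W : normedModType R) (f g : V -> W) (df : V -> W) x :
  (\forall u \near x, f u = g u) -> is_diff x f df -> is_diff x g df.
Proof.
move=> fg fdf.
have fgx : f x = g x by exact: nbhs_singleton fg.
(* The difference vanishes near [x], so its differential is 0; adding it to [f] recovers [g]. *)
suff: is_diff x (g - f) 0.
  move=> gf; have /is_diff_eq : is_diff x (f + (g - f)) (df + 0) by exact: is_diffD.
  move=> /(_ df); rewrite addr0 => /(_ erefl).
  by rewrite addrC subrK.
have h0 : (g - f) \o shift x = cst ((g - f) x) + (0 : V -> W) +o_ 0 id.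
  apply/eqaddoP => _/posnumP[e]; near=> h.
  rewrite -[X in `|X|]/(g (h + x) - f (h + x) - (g x - f x + 0)).
  rewrite fgx subrr addr0 subr0.
  have -> : f (h + x) = g (h + x).
    by near: h; move: fg; rewrite (near_shift 0 x)/= subr0.
  by rewrite subrr normr0 mulr_ge0.
have d0 : 'd (g - f) x = 0 :> (V -> W).
  by apply: (@diff_unique _ _ _ _ \0) => //; exact: cst_continuous.
by apply: DiffDef => //; apply/diff_locallyP; rewrite d0; split => //; exact: cst_continuous.
Unshelve. all: by end_near. Qed.

Lemma near_eq_diff (V W : normedModType R) (f g : V -> W) x :
  (\forall u \near x, f u = g u) -> differentiable f x ->
  differentiable g x /\ 'd g x = 'd f x :> (V -> W).
Proof.
move=> fg /differentiableP df.
by have := near_eq_is_diff fg df; case=> ? ->.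
Qed.

Lemma is_diffE (V W : normedModType R) (f df : V -> W) x :
  is_diff x f df -> 'd f x =1 df.
Proof. by case=> _ ->. Qed.

Lemma is_diff_differentiable (V W : normedModType R) (f df : V -> W) x :
  is_diff x f df -> differentiable f x.
Proof. by case. Qed.

Lemma is_diff_fun (V W : normedModType R) (f g df dg : V -> W) x :
  is_diff x f df -> f =1 g -> df =1 dg -> is_diff x g dg.
Proof. by move=> + /funext <- /funext <-. Qed.

Lemma is_diff_comp_at (U V W : normedModType R) (f df : U -> V) (g dg : V -> W) x y :
  is_diff x f df -> f x = y -> is_diff y g dg ->
  is_diff x (fun u => g (f u)) (fun h => dg (df h)).
Proof. by move=> fdf <- gdg; exact: is_diff_comp. Qed.

Lemma is_diff_fst (V W : normedModType R) (x : V * W) :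
  is_diff x (fst : V * W -> V) fst.
Proof.
have fl : linear (fst : V * W -> V) by [].
pose L : {linear (V * W)%type -> V} := HB.pack (fst : V * W -> V)
  (GRing.isLinear.Build R _ _ _ _ fl).
have Lc : continuous L by move=> y; exact: cvg_fst.
by apply: (@DiffDef _ _ _ _ _ L L); [exact: linear_differentiable|exact: diff_lin].
Qed.

Lemma is_diff_snd (V W : normedModType R) (x : V * W) :
  is_diff x (snd : V * W -> W) snd.
Proof.
have fl : linear (snd : V * W -> W) by [].
pose L : {linear (V * W)%type -> W} := HB.pack (snd : V * W -> W)
  (GRing.isLinear.Build R _ _ _ _ fl).
have Lc : continuous L by move=> y; exact: cvg_snd.
by apply: (@DiffDef _ _ _ _ _ L L); [exact: linear_differentiable|exact: diff_lin].
Qed.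

Lemma is_diff_sum_fin (V W : normedModType R) (I : Type) (s : seq I) (f df : I -> V -> W) x :
  (forall i, is_diff x (f i) (df i)) ->
  is_diff x (fun u => \sum_(i <- s) f i u) (fun h => \sum_(i <- s) df i h).
Proof.
move=> fdf; elim: s => [|i s IH].
  apply: (is_diff_fun (is_diff_cst 0 x)) => u; by rewrite big_nil.
by apply: (is_diff_fun (is_diffD (fdf i) IH)) => u; rewrite big_cons.
Qed.

Lemma is_diff_coord (V : normedModType R) m n (f df : V -> 'M[R]_(m, n)) x i j :
  is_diff x f df -> is_diff x (fun u => f u i j : R^o) (fun h => df h i j).
Proof.
move=> fdf; pose c (M : 'M[R]_(m, n)) : R^o := M i j.
have cl : linear c by move=> a u v; rewrite /c !mxE.
pose cL : {linear 'M[R]_(m, n) -> R^o} :=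
  HB.pack c (GRing.isLinear.Build R _ _ _ _ cl).
have cc : continuous cL by exact: coord_continuous.
have dc : is_diff (f x) cL cL.
  by apply: DiffDef; [exact: linear_differentiable|exact: diff_lin].
exact: (is_diff_comp fdf dc).
Qed.

Lemma is_diff_scalel_fun (V W : normedModType R) (k dk : V -> R^o) (w : W) x :
  is_diff x k dk -> is_diff x (fun u => k u *: w) (fun h => dk h *: w).
Proof. by move=> kdk; exact: (is_diff_comp kdk (is_diff_scalel (k x) w)). Qed.

Lemma is_diff_mx (V : normedModType R) m n (f df : V -> 'M[R]_(m, n)) x :
  (forall i j, is_diff x (fun u => f u i j : R^o) (fun h => df h i j)) ->
  is_diff x f df.
Proof.
move=> fdf.
have H (i : 'I_m) := is_diff_sum_fin (index_enum 'I_n)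
  (fun j => is_diff_scalel_fun (delta_mx i j : 'M[R]_(m, n)) (fdf i j)).
apply: (is_diff_fun (is_diff_sum_fin (index_enum 'I_m) H)) => u;
  by rewrite [RHS]matrix_sum_delta.
Qed.

Lemma is_diffM_fun (V : normedModType R) (f g df dg : V -> R^o) x :
  is_diff x f df -> is_diff x g dg ->
  is_diff x (fun u => f u * g u : R^o) (fun h => f x * dg h + df h * g x).
Proof.
move=> fdf gdg.
apply: (is_diff_fun (is_diffM fdf gdg)) => // h /=.
by rewrite -[LHS]/(f x *: dg h + g x *: df h) [in RHS](mulrC (df h)).
Qed.

Lemma is_diff_mulmx (V : normedModType R) m n p (f df : V -> 'M[R]_(m, n))
    (g dg : V -> 'M[R]_(n, p)) x :
  is_diff x f df -> is_diff x g dg ->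
  is_diff x (fun u => f u *m g u) (fun h => df h *m g x + f x *m dg h).
Proof.
move=> fdf gdg; apply: is_diff_mx => i j.
have H k := is_diffM_fun (is_diff_coord i k fdf) (is_diff_coord k j gdg).
apply: (is_diff_fun (is_diff_sum_fin (index_enum _) H)) => u; rewrite !mxE//.
by rewrite big_split/= addrC.
Qed.

Lemma is_diff_scale_fun (V W : normedModType R) (k dk : V -> R^o)
    (g dg : V -> W) x :
  is_diff x k dk -> is_diff x g dg ->
  is_diff x (fun u => k u *: g u) (fun h => dk h *: g x + k x *: dg h).
Proof.
move=> kdk gdg.
pose sc (a : R^o) (w : W) := a *: w.
have scb : bilinear_for *:%R *:%R sc.
  split=> [w|a] b u v; rewrite /sc/=; first by rewrite scalerDl scalerA.
  by rewrite scalerDr !scalerA mulrC.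
pose scB : {bilinear R^o -> W -> W} :=
  HB.pack sc (bilinear_isBilinear.Build R R^o W W _ _ sc scb).
have scc : continuous (fun p : R^o * W => scB p.1 p.2) by exact: scale_continuous.
have dsc p : is_diff p (fun q : R^o * W => scB q.1 q.2)
    (fun q => scB p.1 q.2 + scB q.1 p.2).
  by apply: DiffDef; [exact: differentiable_bilin|exact: diff_bilin].
apply: (is_diff_fun (is_diff_comp (is_diff_pair kdk gdg) (dsc (k x, g x)))) => // h.
by rewrite /= addrC.
Qed.

(** Finite dimension supplies continuity: a linear map on matrices is a finite combination of the
    entries with constant coefficients. *)
Lemma linear_mx_is_diff (W : normedModType R) m n (f : {linear 'M[R]_(m, n) -> W}) x :
  is_diff x f f.
Proof.
have H i j : is_diff x (fun u : 'M[R]_(m, n) => u i j *: f (delta_mx i j))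
               (fun h : 'M[R]_(m, n) => h i j *: f (delta_mx i j)).
  by apply: is_diff_scalel_fun; exact: is_diff_coord (is_diff_id x).
have K i := is_diff_sum_fin (index_enum 'I_n) (H i).
apply: (is_diff_fun (is_diff_sum_fin (index_enum 'I_m) K)) => u;
  rewrite [in RHS](matrix_sum_delta u) linear_sum; apply: eq_bigr => i _;
  by rewrite linear_sum; apply: eq_bigr => j _; rewrite linearZ.
Qed.

(** Serves matrices built by [lin1_mx], which are accessible through their products with fixed
    rows. *)
Lemma differentiable_rows (V : normedModType R) m n (B : V -> 'M[R]_(m, n)) x :
  (forall w : 'rV_m, differentiable (fun u => w *m B u) x) -> differentiable B x.
Proof.
move=> H; have K (i : 'I_m) := differentiableP (H (delta_mx 0 i)).
have L : is_diff x B (fun h => \matrix_(i, j)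
    ('d (fun u => delta_mx 0 i *m B u : 'rV_n) x h : 'rV_n) 0 j).
  apply: is_diff_mx => i j; apply: (is_diff_fun (is_diff_coord 0 j (K i))) => h.
    by rewrite -rowE mxE.
  by rewrite mxE.
exact: is_diff_differentiable L.
Qed.

Lemma linear_rV_sum (W : normedModType R) n (f : {linear 'rV[R]_n -> W}) v :
  f v = \sum_j v 0 j *: f (delta_mx 0 j).
Proof.
rewrite [in LHS](row_sum_delta v) linear_sum.
by apply: eq_bigr => j _; rewrite linearZ.
Qed.

(** Product rule for ['d F u v] in both variables. Expanding [b] in the standard basis reduces joint
    differentiability to differentiability in [u] for fixed [v]. *)
Lemma is_diff_diff_app (V W : normedModType R) n (F : 'rV[R]_n -> W)
    (a b da db : V -> 'rV[R]_n) p :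
  (forall v, differentiable (fun u => 'd F u v) (a p)) ->
  is_diff p a da -> is_diff p b db ->
  is_diff p (fun q => 'd F (a q) (b q))
    (fun h => 'd F (a p) (db h) + 'd (fun u => 'd F u (b p)) (a p) (da h)).
Proof.
move=> dF ada bdb.
have dFj j := differentiableP (dF (delta_mx 0 j)).
have E v : 'd (fun u => 'd F u v) (a p) =1
    fun h => \sum_j v 0 j *: 'd (fun u => 'd F u (delta_mx 0 j)) (a p) h.
  set dS := (X in _ =1 X).
  suff M : is_diff (a p) (fun u => 'd F u v) dS by exact: is_diffE M.
  have K j := is_diffZ (v 0 j) (dFj j).
  apply: (is_diff_fun (is_diff_sum_fin (index_enum 'I_n) K)) => u.
    by rewrite [RHS]linear_rV_sum.
  by rewrite /dS; apply: eq_bigr => j _; reflexivity.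
have K j := is_diff_scale_fun (is_diff_coord 0 j bdb) (is_diff_comp ada (dFj j)).
apply: (is_diff_fun (is_diff_sum_fin (index_enum 'I_n) K)) => h.
  by rewrite [RHS]linear_rV_sum; reflexivity.
rewrite big_split/=; congr (_ + _).
  exact/esym/linear_rV_sum.
exact/esym/E.
Qed.

Lemma is_diff_line (V : normedModType R) (x v : V) (s : R^o) :
  is_diff s (fun t : R^o => x + t *: v) (fun h : R^o => h *: v).
Proof.
have D := is_diffD (is_diff_cst x s)
  (is_diff_scale_fun (is_diff_id (s : R^o)) (is_diff_cst v s)).
apply: (is_diff_fun D) => // h /=.
by rewrite -[LHS]/(0 + (h *: v + s *: 0)) scaler0 add0r addr0.
Qed.

Lemma is_diff_is_derive (W : normedModType R) (g dg : R^o -> W) (s : R) :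
  is_diff s g dg -> is_derive s 1 g (dg 1).
Proof.
move=> gdg; have dg1 := is_diff_differentiable gdg.
apply: DeriveDef; first exact: diff_derivable.
by rewrite deriveE// diff_val.
Qed.

Definition second_difference (V : normedModType R) (F : V -> R^o) (x v w : V) (t : R) : R :=
  F (x + t *: v + t *: w) - F (x + t *: v) - F (x + t *: w) + F x.

(** The mean value theorem in the direction [v] turns the second difference into [t] times an
    increment of [f = 'd F _ v]; the first-order expansion of [f] at [x] evaluates that
    increment. *)
Lemma second_difference_limit (V : normedModType R) (F : V -> R^o) (x v w : V) (e : R) :
  (\forall u \near x, differentiable F u) ->
  differentiable (fun u => 'd F u v : R^o) x -> 0 < e ->
  exists2 d : R, 0 < d & forall t : R, 0 < t < d ->
    `|second_difference F x v w t - t ^+ 2 * 'd (fun u => 'd F u v : R^o) x w|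
      <= e * t ^+ 2.
Proof.
move=> /nbhs_ballP[r /= r0 dF] df2 e0.
set f := fun u => 'd F u v : R^o.
(* [t * C] bounds every displacement used below; the summand 1 keeps [C] positive when [v] and [w]
   vanish. Two expansion errors occur, each at most [e / (2 * C) * (t * C)], whence the 2. *)
pose C := `|v| + `|w| + 1.
have C0 : 0 < C by rewrite /C ltr_wpDl// addr_ge0.
have e'0 : 0 < e / (2 * C) by rewrite divr_gt0// mulr_gt0.
have := diff_locally df2; rewrite -/f => /eqaddoP/(_ _ e'0)/nbhs_ballP[r' /= r'0 hf].
exists (Num.min r r' / C); first by rewrite divr_gt0// lt_min r0.
move=> t /andP[t0 tC].
have tCr : t * C < r by move: tC; rewrite ltr_pdivlMr// lt_min => /andP[].
have tCr' : t * C < r' by move: tC; rewrite ltr_pdivlMr// lt_min => /andP[].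
have small (s k : R) : 0 <= s <= t -> 0 <= k <= t -> `|s *: v + k *: w| <= t * C.
  move=> /andP[s0 st] /andP[k0 kt]; apply: le_trans (ler_normD _ _) _.
  rewrite !normrZ !ger0_norm// /C !mulrDr mulr1.
  by rewrite -[leLHS]addr0 lerD// ?(ltW t0)// lerD// ler_wpM2r.
have hball (h : V) : `|h| <= t * C ->
    `|f (x + h) - f x - 'd f x h| <= e / (2 * C) * `|h|.
  move=> hC; have := hf h; rewrite -ball_normE /= sub0r normrN => /(_ (le_lt_trans hC tCr')).
  rewrite -[X in `|X| <= _]/(f (h + x) - (f x + 'd f x h)).
  by rewrite opprD addrA addrC (addrC h) [X in `|X|]addrC.
have dFh (h : V) : `|h| <= t * C -> differentiable F (x + h).
  move=> hC; apply: dF; rewrite -ball_normE /= opprD addrA subrr sub0r normrN.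
  exact: le_lt_trans hC tCr.
pose g (s : R^o) : R^o := F (x + s *: v + t *: w) - F (x + s *: v).
have tt : 0 <= t <= t by rewrite ltW/=.
have zt : 0 <= (0 : R) <= t by rewrite lexx ltW.
have gder (s : R) : 0 <= s <= t ->
    is_diff (s : R^o) g (fun h : R^o => h * (f (x + (s *: v + t *: w)) - f (x + s *: v))).
  move=> s0t.
  have L1 : is_diff (s : R^o) (fun k : R^o => x + k *: v + t *: w) (fun h : R^o => h *: v).
    apply: (is_diff_fun (is_diff_line (x + t *: w) v s)) => // k.
    by rewrite addrAC.
  have := dFh _ (small _ _ s0t tt); rewrite addrA => /differentiableP D1.
  have := dFh _ (small _ _ s0t zt); rewrite scale0r addr0 => /differentiableP D2.
  have D := is_diffB (is_diff_comp L1 D1) (is_diff_comp (is_diff_line x v s) D2).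
  apply: (is_diff_fun D) => // h.
  rewrite -[LHS]/('d F _ (h *: v) - 'd F _ (h *: v)).
  rewrite (linearZZ ('d F (x + s *: v + t *: w))) (linearZZ ('d F (x + s *: v))).
  rewrite -scalerBr.
  by [].
have [|||c ct gE] := @MVT R g (fun s => f (x + (s *: v + t *: w)) - f (x + s *: v)) 0 t.
- exact: t0.
- move=> s; rewrite in_itv/= => /andP[/ltW s0 /ltW st].
  have := is_diff_is_derive (gder s _); rewrite mul1r; apply.
  by rewrite s0 st.
- apply: continuous_in_subspaceT => s; rewrite inE/= in_itv/= => st.
  apply: differentiable_continuous; exact: is_diff_differentiable (gder s st).
have c0t : 0 <= c <= t.
  by move: ct; rewrite in_itv/= => /andP[/ltW -> /ltW ->].
have -> : second_difference F x v w t = g t - g 0.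
  rewrite /second_difference /g scale0r addr0; by ring.
rewrite gE subr0 expr2 -mulrA.
rewrite (mulrC _ t) -mulrBr normrM gtr0_norm// (mulrC e) -mulrA ler_wpM2l ?(ltW t0)//.
set k1 := c *: v + t *: w; set k2 := c *: v.
have k2C : `|k2| <= t * C.
  by have := small _ _ c0t zt; rewrite scale0r addr0.
have H1 := hball _ (small _ _ c0t tt).
have H2 := hball _ k2C.
have -> : f (x + k1) - f (x + k2) - t * 'd f x w =
    (f (x + k1) - f x - 'd f x k1) - (f (x + k2) - f x - 'd f x k2).
  have dk2 : 'd f x k2 = c * 'd f x v by exact: linearZZ.
  have dk1 : 'd f x k1 = c * 'd f x v + t * 'd f x w.
    by rewrite -dk2; apply: etrans (linearD _ _ _) _; congr (_ + _); exact: linearZZ.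
  have alg (a1 a2 a3 a4 a5 : R) :
    a1 - a2 - a4 = (a1 - a5 - (a3 + a4)) - (a2 - a5 - a3) by ring.
  by rewrite dk1 dk2; exact: alg.
apply: le_trans (ler_normB _ _) _.
apply: le_trans (lerD H1 H2) _.
rewrite -mulrDr.
have := lerD (small _ _ c0t tt) k2C; rewrite -/k1 => k12.
apply: le_trans (ler_wpM2l (ltW e'0) k12) _.
rewrite le_eqVlt; apply/orP; left; apply/eqP; field.
exact: lt0r_neq0.
Qed.

(* Only differentiability of the two directional derivatives at [x] is needed
   (Young): each mixed derivative is the limit of [second_difference / t ^+ 2]. *)
Lemma schwarz (V : normedModType R) (F : V -> R^o) (x v w : V) :
  (\forall u \near x, differentiable F u) ->
  differentiable (fun u => 'd F u v : R^o) x ->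
  differentiable (fun u => 'd F u w : R^o) x ->
  'd (fun u => 'd F u v : R^o) x w = 'd (fun u => 'd F u w : R^o) x v.
Proof.
move=> dF dv dw; apply/eqP; rewrite -subr_eq0 -normr_le0.
apply/ler_addgt0Pr => e e0; rewrite add0r.
have e20 : 0 < e / 2 by rewrite divr_gt0.
have [d1 d10 H1] := second_difference_limit w dF dv e20.
have [d2 d20 H2] := second_difference_limit v dF dw e20.
pose t := Num.min d1 d2 / 2.
have t0 : 0 < t by rewrite divr_gt0// lt_min d10.
have t1 : t < d1.
  by rewrite /t ltr_pdivrMr// gt_min ltr_pMr// ltr1n.
have t2 : t < d2.
  by rewrite /t ltr_pdivrMr// gt_min !ltr_pMr// ltr1n orbT.
have {}H1 := H1 t (introT andP (conj t0 t1)).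
have {}H2 := H2 t (introT andP (conj t0 t2)).
have S : second_difference F x w v t = second_difference F x v w t.
  rewrite /second_difference (addrAC x); congr (_ + _).
  exact: (addrAC (F _ : R)).
rewrite S in H2.
move: H1 H2; set D := second_difference _ _ _ _ _.
set p := 'd _ x w; set q := 'd _ x v => H1 H2.
have t20 : 0 < t ^+ 2 by rewrite exprn_gt0.
rewrite -(ler_pM2l t20) (mulrC _ e) (splitr e) mulrDl.
apply: le_trans (lerD H2 H1); apply: le_trans (ler_normB _ _).
rewrite -[X in X * _](gtr0_norm t20) -normrM le_eqVlt; apply/orP; left.
apply/eqP; congr (`| _ |).
have alg (a1 a2 a3 a4 : R) : a4 * (a1 - a2) = (a3 - a4 * a2) - (a3 - a4 * a1) by ring.
exact: alg.
Qed.

Lemma schwarz_mx (V : normedModType R) m n (F : V -> 'M[R]_(m, n)) (x v w : V) :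
  (\forall u \near x, differentiable F u) ->
  (forall v, differentiable (fun u => 'd F u v) x) ->
  'd (fun u => 'd F u v) x w = 'd (fun u => 'd F u w) x v.
Proof.
move=> dF d2F; apply/matrixP => i j.
have dFij : \forall u \near x, forall h,
    ('d F u h) i j = 'd (fun u => F u i j : R^o) u h.
  near=> u => h; have /differentiableP dFu : differentiable F u by near: u.
  by rewrite (is_diffE (is_diff_coord i j dFu)).
have d2Fij h : differentiable (fun u => 'd (fun u => F u i j : R^o) u h : R^o) x
    /\ forall k, 'd (fun u => 'd F u h) x k i j =
    'd (fun u => 'd (fun u => F u i j : R^o) u h : R^o) x k.
  have /(is_diff_coord i j) H := differentiableP (d2F h).
  have /near_eq_is_diff/(_ H) K :
    \forall u \near x, 'd F u h i j = 'd (fun u => F u i j : R^o) u h.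
    by near=> u; rewrite (near dFij u).
  by case: K => ? ->.
rewrite (d2Fij v).2 (d2Fij w).2; apply: schwarz.
- near=> u; have /differentiableP dFu : differentiable F u by near: u.
  exact: is_diff_differentiable (is_diff_coord i j dFu).
- exact: (d2Fij v).1.
- exact: (d2Fij w).1.
Unshelve. all: by end_near. Qed.

End Differentials.

(** * Smooth maps *)

Section Smooth.
Context {R : realType}.
Implicit Types E F G : normedModType R.

Lemma Ck_subset E F k (U V : set E) (f : E -> F) : V `<=` U -> Ck k U f -> Ck k V f.
Proof.
move=> VU; elim: k f => [f H u /VU|k IH f [H1 H2]]; first exact: H.
by split=> [u /VU|v]; [exact: H1|exact: IH (H2 v)].
Qed.

Lemma eq_Ck E F k (U : set E) (f g : E -> F) :
  open U -> (forall u, U u -> f u = g u) -> Ck k U f -> Ck k U g.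
Proof.
move=> oU; have nearU f' g' : (forall u, U u -> f' u = g' u) ->
    forall u, U u -> \forall u' \near u, f' u' = g' u' :> F.
  move=> fg u Uu; have : nbhs u U by exact: open_nbhs_nbhs.
  by apply: filterS => u'; exact: fg.
elim: k f g => [f g fg H u Uu|k IH f g fg [H1 H2]].
  rewrite /prop_for /continuous_at -(fg _ Uu); apply: cvg_trans (H u Uu).
  exact/near_eq_cvg/nearU.
have fgd u : U u -> differentiable g u /\ 'd g u = 'd f u :> (E -> F).
  by move=> Uu; apply: near_eq_diff; [exact: nearU|exact: H1].
split=> [u /fgd[]//|v]; apply: IH (H2 v) => u Uu.
by rewrite (fgd u Uu).2.
Qed.

Lemma smooth_near_eq E F (f g : E -> F) u :
  (\forall u' \near u, f u' = g u') -> smooth_near f u -> smooth_near g u.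
Proof.
move=> fg [U [oU Uu] CU].
have : nbhs u (U `&` [set u' | f u' = g u']).
  by apply: filterI => //; exact: open_nbhs_nbhs.
rewrite nbhsE => -[V [oV Vu] VU]; exists V => // k.
apply: (eq_Ck oV) (Ck_subset _ (CU k)); by move=> u' /VU[].
Qed.

Lemma smooth_near_near E F (f : E -> F) u :
  smooth_near f u -> \forall u' \near u, smooth_near f u'.
Proof.
move=> [U [oU Uu] CU].
have : nbhs u U by exact: open_nbhs_nbhs.
by apply: filterS => u' Uu'; exists U.
Qed.

Lemma smooth_near_differentiable E F (f : E -> F) u :
  smooth_near f u -> differentiable f u.
Proof. by move=> [U [_ Uu] /(_ 1)[+ _]]; apply. Qed.

Lemma smooth_near_diff E F (f : E -> F) u v :
  smooth_near f u -> smooth_near (fun u => 'd f u v) u.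
Proof. by move=> [U Uu CU]; exists U => // k; case: (CU k.+1) => _; apply. Qed.

Lemma Ck_continuous E F k (U : set E) (f : E -> F) u :
  Ck k U f -> U u -> {for u, continuous f}.
Proof.
case: k => [|k]; first exact.
by case=> + _ Uu => /(_ u Uu)/differentiable_continuous.
Qed.

Lemma Ck_cst E F k (U : set E) (a : F) : open U -> Ck k U (fun _ : E => a).
Proof.
move=> oU; elim: k a => [a u _|k IH a]; first exact: cvg_cst.
split=> [u _|v]; first exact: differentiable_cst.
apply: eq_Ck (IH 0) => // u _.
by rewrite (is_diffE (is_diff_cst a u)).
Qed.

(* The differential [df] is the same at every point, i.e. [f] is affine. *)
Lemma Ck_affine E F k (U : set E) (f df : E -> F) :
  open U -> (forall u, is_diff u f df) -> Ck k U f.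
Proof.
move=> oU fdf; case: k => [u _|k].
  exact: differentiable_continuous (is_diff_differentiable (fdf u)).
split=> [u _|v]; first exact: is_diff_differentiable (fdf u).
apply: eq_Ck (Ck_cst k (df v) oU) => // u _.
by rewrite (is_diffE (fdf u)).
Qed.

Lemma CkD E F k (U : set E) (f g : E -> F) : open U ->
  Ck k U f -> Ck k U g -> Ck k U (fun u => f u + g u).
Proof.
move=> oU; elim: k f g => [f g Cf Cg u Uu|k IH f g [df Cf] [dg Cg]].
  by apply: cvgD; [exact: Cf|exact: Cg].
have D u : U u -> is_diff u (fun u => f u + g u) (fun h => 'd f u h + 'd g u h).
  move=> Uu; have := is_diffD (differentiableP (df u Uu)) (differentiableP (dg u Uu)).
  by move=> H; exact: (is_diff_fun H).
split=> [u /D/is_diff_differentiable//|v].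
apply: (eq_Ck oU _ (IH _ _ (Cf v) (Cg v))) => u Uu.
exact: (esym (is_diffE (D u Uu) v)).
Qed.

Lemma Ck_pair E F G k (U : set E) (f : E -> F) (g : E -> G) : open U ->
  Ck k U f -> Ck k U g -> Ck k U (fun u => (f u, g u)).
Proof.
move=> oU; elim: k f g => [f g Cf Cg u Uu|k IH f g [df Cf] [dg Cg]].
  by apply: cvg_pair; [exact: Cf|exact: Cg].
have D u : U u -> is_diff u (fun u => (f u, g u)) (fun h => ('d f u h, 'd g u h)).
  by move=> Uu; exact: is_diff_pair (differentiableP (df u Uu)) (differentiableP (dg u Uu)).
split=> [u /D/is_diff_differentiable//|v].
apply: (eq_Ck oU _ (IH _ _ (Cf v) (Cg v))) => u Uu.
exact: (esym (is_diffE (D u Uu) v)).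
Qed.

Lemma Ck_linear_mx E F k (U : set E) m n (f : E -> 'M[R]_(m, n))
  (L : {linear 'M[R]_(m, n) -> F}) : open U -> Ck k U f -> Ck k U (fun u => L (f u)).
Proof.
move=> oU; elim: k f => [f Cf u Uu|k IH f [df Cf]].
  apply: continuous_comp; first exact: Cf.
  exact: differentiable_continuous (is_diff_differentiable (linear_mx_is_diff L _)).
have D u : U u -> is_diff u (fun u => L (f u)) (fun h => L ('d f u h)).
  by move=> Uu; exact: is_diff_comp (differentiableP (df u Uu)) (linear_mx_is_diff L _).
split=> [u /D/is_diff_differentiable//|v].
apply: (eq_Ck oU _ (IH _ (Cf v))) => u Uu.
exact: (esym (is_diffE (D u Uu) v)).
Qed.

Lemma continuous_mulmx m n p : continuous (fun AB : 'M[R]_(m, n) * 'M[R]_(n, p) => AB.1 *m AB.2).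
Proof.
move=> AB; apply: differentiable_continuous.
have d1 := is_diff_fst AB.
have d2 := is_diff_snd AB.
exact: is_diff_differentiable (is_diff_mulmx d1 d2).
Qed.

Lemma Ck_mulmx E k (U : set E) m n p (f : E -> 'M[R]_(m, n)) (g : E -> 'M[R]_(n, p)) :
  open U -> Ck k U f -> Ck k U g -> Ck k U (fun u => f u *m g u).
Proof.
move=> oU; elim: k f g => [f g Cf Cg u Uu|k IH f g Cf' Cg'].
  have C : (fun u => (f u, g u)) @ u --> (f u, g u).
    by apply: (cvg_pair (Cf u Uu) (Cg u Uu)).
  exact: (continuous_comp C (@continuous_mulmx m n p _)).
have [[df Cf] [dg Cg]] := (Cf', Cg').
have D u : U u -> is_diff u (fun u => f u *m g u)
    (fun h => 'd f u h *m g u + f u *m 'd g u h).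
  by move=> Uu; exact: is_diff_mulmx (differentiableP (df u Uu)) (differentiableP (dg u Uu)).
(* The product rule leaves one factor undifferentiated, so the induction needs that C^(k+1) implies
   C^k. *)
have CkS F (h : E -> F) : Ck k.+1 U h -> Ck k U h.
  elim: k {IH Cf' Cg' Cf Cg} h => [h Ch u Uu|k IH h [dh Ch]].
    exact: Ck_continuous Ch Uu.
  by split=> [//|v]; exact: IH (Ch v).
split=> [u /D/is_diff_differentiable//|v].
apply: (@eq_Ck _ _ _ _ (fun u => 'd f u v *m g u + f u *m 'd g u v)) => //.
  by move=> u Uu; exact: (esym (is_diffE (D u Uu) v)).
exact: (CkD oU (IH _ _ (Cf v) (CkS _ _ Cg')) (IH _ _ (CkS _ _ Cf') (Cg v))).
Qed.

Lemma differentiable_det E n (A : E -> 'M[R]_n) x :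
  differentiable A x -> differentiable (fun u => \det (A u) : R^o) x.
Proof.
move=> dA.
have dAij i j : differentiable (fun u => A u i j : R^o) x.
  exact: is_diff_differentiable (is_diff_coord i j (differentiableP dA)).
rewrite /determinant.
have P (s : 'I_n -> 'I_n) (r : seq 'I_n) :
    differentiable (fun u => \prod_(i <- r) A u i (s i) : R^o) x.
  elim: r => [|i r IH].
    have -> : (fun u => \prod_(i <- [::]) A u i (s i) : R^o) = cst (1 : R^o).
      by apply/funext => u; rewrite big_nil.
    exact: differentiable_cst.
  have -> : (fun u => \prod_(i <- i :: r) A u i (s i) : R^o) =
    (fun u => A u i (s i) : R^o) * (fun u => \prod_(i <- r) A u i (s i) : R^o).
    by apply/funext => u; rewrite big_cons.
  exact: differentiableM.
have S (s : {perm 'I_n}) := is_diffZ ((-1) ^+ s : R) (differentiableP (P s (index_enum 'I_n))).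
exact: is_diff_differentiable (is_diff_sum_fin (index_enum {perm 'I_n}) S).
Qed.

Lemma unitmx_near E n (A : E -> 'M[R]_n) x :
  differentiable A x -> A x \in unitmx -> \forall u \near x, A u \in unitmx.
Proof.
move=> /differentiable_det/differentiable_continuous dA.
rewrite unitmxE unitfE => A0.
have N : nbhs (\det (A x) : R^o) [set r : R^o | r != 0].
  by apply: open_nbhs_nbhs; split => //; exact: open_neq.
have M : \forall u \near x, \det (A u) != 0 by exact: dA N.
by apply: filterS M => u; rewrite unitmxE unitfE.
Qed.

(** Differentiability comes from Cramer's formula, adjugate over determinant. The value of the
    differential is then read off by differentiating [invmx (A u) *m A u = 1]. *)
Lemma is_diff_invmx E n (A dA : E -> 'M[R]_n) x :
  is_diff x A dA -> A x \in unitmx ->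
  is_diff x (fun u => invmx (A u)) (fun h => - (invmx (A x) *m dA h *m invmx (A x))).
Proof.
move=> AdA Ax.
have dA' := is_diff_differentiable AdA.
have dinv : differentiable (fun u => invmx (A u)) x.
  have ddet := differentiable_det dA'.
  have dadj : differentiable (fun u => \adj (A u)) x.
    have K i j : differentiable (fun u => \adj (A u) i j : R^o) x.
      have -> : (fun u => \adj (A u) i j : R^o) =
          (fun u => (-1) ^+ (j + i) *: (\det (row' j (col' i (A u))) : R^o)).
        by apply/funext => u; rewrite mxE.
      apply: differentiableZ; apply: differentiable_det.
      pose L (B : 'M[R]_n) : 'M[R]_n.-1 := row' j (col' i B).
      have Ll : linear L by move=> a B C; apply/matrixP => k l; rewrite !mxE.
      pose LL : {linear 'M[R]_n -> 'M[R]_n.-1} := HB.pack L (GRing.isLinear.Build R _ _ _ _ Ll).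
      exact: is_diff_differentiable (is_diff_comp AdA (linear_mx_is_diff LL _)).
    have H : is_diff x (fun u => \adj (A u))
        (fun h => \matrix_(i, j) ('d (fun u => \adj (A u) i j : R^o) x h : R)).
      apply: is_diff_mx => i j.
      by apply: (is_diff_fun (differentiableP (K i j))) => // h; rewrite mxE.
    exact: is_diff_differentiable H.
  have d0 : \det (A x) != 0 by rewrite -unitfE -unitmxE.
  have dV := differentiableV ddet d0.
  have H := is_diff_scale_fun (differentiableP dV) (differentiableP dadj).
  refine (is_diff_differentiable (near_eq_is_diff _ H)).
  by near=> u; rewrite /invmx ifT//; near: u; exact: unitmx_near.
have H := is_diff_mulmx (differentiableP dinv) AdA.
have one : is_diff x (fun u => invmx (A u) *m A u) (0 : E -> 'M[R]_n).
  apply: near_eq_is_diff (is_diff_cst (1%:M : 'M[R]_n) x).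
  by near=> u; rewrite mulVmx//; near: u; exact: unitmx_near.
apply: (is_diff_fun (differentiableP dinv)) => // h.
have : 'd (fun u => invmx (A u)) x h *m A x + invmx (A x) *m dA h = 0.
  by rewrite -(is_diffE H) (is_diffE one).
move/eqP; rewrite addr_eq0 => /eqP K.
by rewrite -[LHS](mulmxK Ax) K mulNmx.
Unshelve. all: by end_near. Qed.

(** Bootstrapping: the differential of the inverse is a product of ['d A] and two copies of the
    inverse, so C^k for the inverse yields C^(k+1). *)
Lemma Ck_invmx E k (U : set E) n (A : E -> 'M[R]_n) :
  open U -> (forall k, Ck k U A) -> (forall u, U u -> A u \in unitmx) ->
  Ck k U (fun u => invmx (A u)).
Proof.
move=> oU CA uA.
have D u : U u -> is_diff u (fun u => invmx (A u))
    (fun h => - (invmx (A u) *m 'd A u h *m invmx (A u))).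
  by move=> Uu; apply: is_diff_invmx (uA _ Uu); exact: differentiableP ((CA 1).1 u Uu).
elim: k => [u /D/is_diff_differentiable/differentiable_continuous//|k IH].
split=> [u /D/is_diff_differentiable//|v].
have K := Ck_mulmx oU (Ck_mulmx oU IH ((CA k.+1).2 v)) IH.
have N := @Ck_linear_mx _ _ k U n n _ -%R oU K.
apply: (eq_Ck oU _ N) => u Uu; exact: (esym (is_diffE (D u Uu) v)).
Qed.

End Smooth.

(** * Atlases, tangent vectors and chart changes *)

Section Atlas.
Context {R : realType}.

(* The chart-change condition for targets of maps. Unlike [atlas] it does not
   require the image of a chart to be a neighbourhood, so that it can be checked
   on the frame groupoid directly from the formula for its transition maps. *)
Definition compatible (F : normedModType R) (S : choiceType) (B : charted F S) :=
  forall (e e' : chart B) z, dom e z -> dom e' z ->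
  exists2 th : F -> F, differentiable th (coord e z) &
    \forall p \near coord e z, forall z', dom e z' -> coord e z' = p ->
      dom e' z' /\ coord e' z' = th p.

(** What first-order calculus in charts requires, without a topology on [S]: it covers the manifold,
    its tangent bundle (a bare type of pairs) and the line alike. *)
Definition atlas (F : normedModType R) (S : choiceType) (B : charted F S) :=
  [/\ forall (e : chart B) z z', dom e z -> dom e z' -> coord e z = coord e z' -> z = z',
      forall (e : chart B) z, dom e z ->
        \forall p \near coord e z, exists2 z', dom e z' & coord e z' = p &
      compatible B].

Lemma tangent_inj (E : normedModType R) (T : choiceType) (A : charted E T) x
  (v w : tangent A x) : (v : chart A -> E) = w -> v = w.
Proof. exact: val_inj. Qed.

Lemma tangent_out (E : normedModType R) (T : choiceType) (A : charted E T) x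
  (v : tangent A x) c : ~ dom c x -> v c = 0.
Proof. by move=> nx; case: v => v /= /asboolP[/(_ c nx)]. Qed.

Lemma tangent_trans (E : normedModType R) (T : choiceType) (A : charted E T) x
  (v : tangent A x) c d : dom c x -> dom d x ->
  v d = 'd (coord d \o inv_coord c x) (coord c x) (v c).
Proof. by move=> cx dx; case: v => v /= /asboolP[_ /(_ c d cx dx)]. Qed.

Lemma tangentD (E : normedModType R) (T : choiceType) (A : charted E T) x
  (v w : tangent A x) c : (v + w) c = v c + w c.
Proof. by []. Qed.

Lemma tangentZ (E : normedModType R) (T : choiceType) (A : charted E T) x
  a (v : tangent A x) c : (a *: v) c = a *: v c.
Proof. by []. Qed.

Section OneAtlas.
Context {F : normedModType R} {S : choiceType} {B : charted F S}.
Hypothesis HB : atlas B.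
Implicit Types (c d e : chart B) (x y z : S).

Lemma atlas_compatible : compatible B. Proof. by case: HB. Qed.

Lemma inv_coord_eq c x z u : dom c z -> coord c z = u -> inv_coord c x u = z.
Proof.
move=> cz <-; rewrite /inv_coord; case: xgetP => [z' _ [cz' /esym]|/(_ z) H].
  by move=> zz'; case: HB => + _ _ => /(_ c z z' cz cz' zz') ->.
by case: H.
Qed.

Lemma coordK c x z : dom c z -> inv_coord c x (coord c z) = z.
Proof. by move=> cz; exact: inv_coord_eq. Qed.

Lemma near_inv_coord c x z : dom c z ->
  \forall p \near coord c z, dom c (inv_coord c x p) /\ coord c (inv_coord c x p) = p.
Proof.
case: HB => _ im _ /im; apply: filterS => p [z' cz' <-].
by rewrite coordK.
Qed.

(** The base point passed to [inv_coord] is only a default outside the image of the chart, but it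
    varies between occurrences; this lemma lets differentials ignore it. *)
Lemma near_inv_coord_default c x y z : dom c z ->
  \forall p \near coord c z, inv_coord c x p = inv_coord c y p.
Proof.
case: HB => _ im _ /im; apply: filterS => p [z' cz' <-].
by rewrite !coordK.
Qed.

Lemma transitionP c d x z : dom c z -> dom d z ->
  (\forall p \near coord c z, dom d (inv_coord c x p)) /\
  differentiable (coord d \o inv_coord c x) (coord c z).
Proof.
move=> cz dz; case: HB => _ _ /(_ c d z cz dz)[th dth Hth].
have near_th : \forall p \near coord c z, [/\ dom d (inv_coord c x p) &
    th p = (coord d \o inv_coord c x) p].
  near=> p.
  have [cp pE] : dom c (inv_coord c x p) /\ coord c (inv_coord c x p) = p.
    by near: p; exact: near_inv_coord.
  have [? thE] : dom d (inv_coord c x p) /\ coord d (inv_coord c x p) = th p.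
    by move: cp pE; near: p; apply: filterS Hth => p; apply.
  by split=> //; rewrite /= thE.
split; first by apply: filterS near_th => p [].
have /near_eq_diff/(_ dth)[//] : \forall p \near coord c z, th p = (coord d \o inv_coord c x) p.
by apply: filterS near_th => p [].
Unshelve. all: by end_near. Qed.

Lemma diff_transition_default c d x y z : dom c z -> dom d z ->
  'd (coord d \o inv_coord c x) (coord c z) =1 'd (coord d \o inv_coord c y) (coord c z).
Proof.
move=> cz dz h.
have N : \forall p \near coord c z, (coord d \o inv_coord c y) p = (coord d \o inv_coord c x) p.
  by apply: filterS (near_inv_coord_default y x cz) => p /= ->.
by have [_ ->] := near_eq_diff N (transitionP y cz dz).2.
Qed.

Lemma diff_transition_id c x z : dom c z ->
  'd (coord c \o inv_coord c x) (coord c z) =1 id.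
Proof.
move=> cz; apply: is_diffE; apply: near_eq_is_diff (is_diff_id _).
by apply: filterS (near_inv_coord x cz) => p [_ /= ->].
Qed.

Lemma diff_transition_comp c d e x z v : dom c z -> dom d z -> dom e z ->
  'd (coord e \o inv_coord c x) (coord c z) v =
  'd (coord e \o inv_coord d x) (coord d z) ('d (coord d \o inv_coord c x) (coord c z) v).
Proof.
move=> cz dz ez.
have [Nd /differentiableP Dcd] := transitionP x cz dz.
have [Ne /differentiableP Dde] := transitionP x dz ez.
have E : (coord d \o inv_coord c x) (coord c z) = coord d z by rewrite /= coordK.
have D := is_diff_comp_at Dcd E Dde.
have N : \forall p \near coord c z,
    (coord e \o inv_coord d x) ((coord d \o inv_coord c x) p) = (coord e \o inv_coord c x) p.
  by apply: filterS Nd => p dp /=; rewrite coordK.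
exact: is_diffE (near_eq_is_diff N D) v.
Qed.

Lemma tangent_at_inj x (v w : tangent B x) c : dom c x -> v c = w c -> v = w.
Proof.
move=> cx vw; apply: tangent_inj; apply/funext => d.
have [dx|ndx] := pselect (dom d x); last by rewrite !tangent_out.
by rewrite (tangent_trans v cx dx) (tangent_trans w cx dx) vw.
Qed.

(** The components in the other charts are forced by the transition maps, and the chain rule
    [diff_transition_comp] makes them consistent. *)
Lemma tangent_ex x c (v : F) : dom c x -> exists w : tangent B x, w c = v.
Proof.
move=> cx.
pose w := fun d => if pselect (dom d x) then 'd (coord d \o inv_coord c x) (coord c x) v else 0.
have wP : w \in tangent_family x.
  apply/asboolP; split=> [d ndx|d e dx ex]; rewrite /w; first by case: pselect => /=.
  case: pselect => //= _; case: pselect => //= _.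
  exact: diff_transition_comp.
exists (Tangent wP); rewrite /= /w; case: pselect => //= _.
exact: diff_transition_id.
Qed.

Lemma xget_tangent x (v : chart B -> F) c : dom c x ->
  (forall d, dom d x -> v d = 'd (coord d \o inv_coord c x) (coord c x) (v c)) ->
  forall d, dom d x ->
  (xget 0 [set w : tangent B x | forall d, dom d x -> w d = v d]) d = v d.
Proof.
move=> cx vE d dx; case: xgetP => [w _ /(_ d dx)//|/= H].
have [w wc] := tangent_ex (v c) cx; case: (H w) => e ex.
by rewrite vE// (tangent_trans w cx ex) wc.
Qed.

End OneAtlas.

Section Maps.
Context {E F : normedModType R} {T S : choiceType} {A : charted E T} {B : charted F S}.
Hypotheses (HA : atlas A) (HB : compatible B).
Implicit Types (c : chart A) (e : chart B) (f g : T -> S).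

Definition maps_near f x c e :=
  \forall u \near coord c x, dom e (f (inv_coord c x u)).

Definition diff_at f x := exists c e,
  [/\ dom c x, dom e (f x), maps_near f x c e & differentiable (local_expr f x c e) (coord c x)].

Lemma smooth_at_diff_at f x : smooth_at A B f x -> diff_at f x.
Proof.
by move=> [c [e [cx ex N /smooth_near_differentiable D]]]; exists c, e.
Qed.

Lemma local_expr_at f x c e : dom c x -> local_expr f x c e (coord c x) = coord e (f x).
Proof. by move=> cx; rewrite /local_expr (coordK HA). Qed.

(** [th] is chosen before [f] and [D]. Two maps with the same value and the same differential in one
    pair of charts are thus transported by the same formula, which is what makes equality of 1-jets
    independent of the charts. *)
Lemma change_charts x z c c' e e' :
  dom c x -> dom c' x -> dom e z -> dom e' z ->
  exists th : F -> F, forall f D, f x = z -> maps_near f x c e ->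
    is_diff (coord c x) (local_expr f x c e) D ->
    maps_near f x c' e' /\
    is_diff (coord c' x) (local_expr f x c' e')
      (fun h => th (D ('d (coord c \o inv_coord c' x) (coord c' x) h))).
Proof.
move=> cx c'x ez e'z; have [th dth Hth] := HB ez e'z.
exists ('d th (coord e z)) => f D fx N DD.
have [Nc Dc] := transitionP HA x c'x cx.
have E1 : (coord c \o inv_coord c' x) (coord c' x) = coord c x by rewrite /= (coordK HA).
have E2 : local_expr f x c e (coord c x) = coord e z by rewrite local_expr_at// fx.
have Cc : (coord c \o inv_coord c' x) u @[u --> coord c' x] --> coord c x.
  by rewrite -E1; exact: differentiable_continuous Dc.
have Ce : local_expr f x c e u @[u --> coord c x] --> coord e z.
  by rewrite -E2; exact: differentiable_continuous (is_diff_differentiable DD).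
have Hth' : \forall u \near coord c' x, forall z', dom e z' ->
    coord e z' = local_expr f x c e (coord c (inv_coord c' x u)) ->
    dom e' z' /\ coord e' z' = th (local_expr f x c e (coord c (inv_coord c' x u))).
  exact: Cc _ (Ce _ Hth).
have key : \forall u \near coord c' x,
    dom e' (f (inv_coord c' x u)) /\
    th (local_expr f x c e (coord c (inv_coord c' x u))) = local_expr f x c' e' u.
  have N' : \forall u \near coord c' x,
    dom e (f (inv_coord c x (coord c (inv_coord c' x u)))) by exact: Cc _ N.
  apply: filterS3 Nc N' Hth' => u cu; rewrite (coordK HA)// => eu H.
  have L : local_expr f x c e (coord c (inv_coord c' x u)) = coord e (f (inv_coord c' x u)).
    by rewrite /local_expr (coordK HA).
  have [? thE] := H _ eu (esym L).
  by rewrite -thE.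
split; first by apply: filterS key => u [].
have Q := is_diff_comp_at (differentiableP Dc) E1 (is_diff_comp_at DD E2 (differentiableP dth)).
refine (near_eq_is_diff _ Q).
by apply: filterS key => u [].
Qed.

Lemma diff_at_charts f x c e : diff_at f x -> dom c x -> dom e (f x) ->
  maps_near f x c e /\ differentiable (local_expr f x c e) (coord c x).
Proof.
move=> [c0 [e0 [c0x e0x N /differentiableP D]]] cx ex.
have [th /(_ f _ erefl N D)[N' D']] := change_charts c0x cx e0x ex.
by split; [|exact: is_diff_differentiable D'].
Qed.

Lemma same_jet1_charts f g x c e : f x = g x -> dom c x -> dom e (f x) ->
  diff_at f x -> diff_at g x ->
  'd (local_expr f x c e) (coord c x) =1 'd (local_expr g x c e) (coord c x) ->
  same_jet1 A B f g x.
Proof.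
move=> fg cx ex df dg fgE; split=> // c' e' c'x e'x h.
have [th H] := change_charts cx c'x ex e'x.
have [Nf /differentiableP Df] := diff_at_charts df cx ex.
have egx : dom e (g x) by rewrite -fg.
have [Ng /differentiableP Dg] := diff_at_charts dg cx egx.
have [_ /is_diffE ->] := H f _ erefl Nf Df.
have [_ /is_diffE ->] := H g _ (esym fg) Ng Dg.
by rewrite fgE.
Qed.

End Maps.

Section TangentMaps.
Context {E F : normedModType R} {T S : choiceType} {A : charted E T} {B : charted F S}.
Hypotheses (HA : atlas A) (HB : atlas B).
Implicit Types (c : chart A) (e : chart B) (f g : T -> S).

Lemma diff_local_expr_transition f x c c' e e' h :
  dom c x -> dom c' x -> dom e (f x) -> dom e' (f x) -> diff_at (A := A) (B := B) f x ->
  'd (local_expr f x c' e') (coord c' x) ('d (coord c' \o inv_coord c x) (coord c x) h) =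
  'd (coord e' \o inv_coord e (f x)) (coord e (f x)) ('d (local_expr f x c e) (coord c x) h).
Proof.
move=> cx c'x ex e'x df.
have [N1 /differentiableP D1] := diff_at_charts HA (atlas_compatible HB) df cx ex.
have [N2 /differentiableP D2] := diff_at_charts HA (atlas_compatible HB) df c'x e'x.
have [Nc /differentiableP Dc] := transitionP HA x cx c'x.
have [Ne /differentiableP De] := transitionP HB (f x) ex e'x.
have Ec : (coord c' \o inv_coord c x) (coord c x) = coord c' x by rewrite /= (coordK HA).
have Ee : local_expr f x c e (coord c x) = coord e (f x) by rewrite local_expr_at.
have L := is_diff_comp_at Dc Ec D2; have Q := is_diff_comp_at D1 Ee De.
have N : \forall u \near coord c x,
    local_expr f x c' e' ((coord c' \o inv_coord c x) u) =
    (coord e' \o inv_coord e (f x)) (local_expr f x c e u).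
  near=> u.
  have c'u : dom c' (inv_coord c x u) by near: u.
  have eu : dom e (f (inv_coord c x u)) by near: u.
  by rewrite /local_expr /= (coordK HA)// (coordK HB).
apply: etrans (esym (is_diffE (near_eq_is_diff N L) h)) _.
exact: is_diffE Q h.
Unshelve. all: by end_near. Qed.

Lemma tdiffE f x (v : tangent A x) c e : diff_at (A := A) (B := B) f x ->
  dom c x -> dom e (f x) ->
  tdiff A B f v e = 'd (local_expr f x c e) (coord c x) (v c).
Proof.
move=> df cx ex; rewrite /tdiff; case: xgetP => [w _ /(_ c e cx ex)//|/= H].
have [w we] := tangent_ex HB ('d (local_expr f x c e) (coord c x) (v c)) ex.
case: (H w) => c' e' c'x e'x.
rewrite (tangent_trans w ex e'x) we (tangent_trans v cx c'x).
exact/esym/diff_local_expr_transition.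
Qed.

Lemma self_atlas (G : normedModType R) : atlas (self_charted G).
Proof.
split=> [e z z' _ _ //|e z _|e e' z _ _].
  by near=> p; exists p.
exists id; first exact: is_diff_differentiable (is_diff_id _).
by near=> p => z' _.
Unshelve. all: by end_near. Qed.

End TangentMaps.

Section Velocity.
Context {F : normedModType R} {S : choiceType} {B : charted F S}.
Hypothesis HB : atlas B.

Lemma self_inv_coord (G : normedModType R) (e : chart (self_charted G)) u0 u :
  inv_coord e u0 u = u.
Proof. by rewrite (inv_coord_eq (self_atlas G) u0 (z := u)). Qed.

Lemma velocityE (g : R^o -> S) (e : chart B) (D : R^o -> F) :
  dom e (g 0) -> (\forall t \near (0 : R^o), dom e (g t)) ->
  is_diff (0 : R^o) (fun t => coord e (g t)) D ->
  tagged (velocity B g) e = D 1.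
Proof.
move=> e0 N DD.
(* Treating [g] as a map from the one-chart manifold [R^o] lets the general chart-change formula
   relate its derivatives in different charts. *)
have dg : diff_at (A := self_charted R^o) (B := B) g 0.
  exists tt, e; split => //.
    by apply: filterS N => t; rewrite self_inv_coord.
  refine (is_diff_differentiable (near_eq_is_diff _ DD)).
  by near=> t; rewrite /local_expr self_inv_coord.
have gE (d : chart B) : dom d (g 0) -> derive1 (fun t : R => coord d (g t)) 0 =
    'd (local_expr (A := self_charted R^o) g 0 tt d) (0 : R^o) 1.
  move=> d0.
  have [_ /differentiableP D'] :=
    diff_at_charts (self_atlas R^o) (atlas_compatible HB) (c := tt) dg I d0.
  have D'' : is_diff (0 : R^o) (fun t : R^o => coord d (g t))
      ('d (local_expr (A := self_charted R^o) g 0 tt d) (0 : R^o)).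
    apply: near_eq_is_diff D'.
    by near=> t; rewrite /local_expr self_inv_coord.
  rewrite derive1E'; last exact: is_diff_differentiable D''.
  exact: is_diffE D'' 1.
have -> : D 1 = derive1 (fun t : R => coord e (g t)) 0.
  rewrite derive1E'; last exact: is_diff_differentiable DD.
  by rewrite (is_diffE DD).
rewrite /velocity /=; apply: (xget_tangent HB e0 _ e0) => d d0.
rewrite gE// gE//.
rewrite -(diff_local_expr_transition (self_atlas R^o) HB (c := tt) (c' := tt))//.
congr ('d _ _ _); exact/esym/(diff_transition_id (self_atlas R^o)).
Unshelve. all: by end_near. Qed.

End Velocity.

End Atlas.

(** * The tangent and second tangent bundles *)

Section Manifold.
Context {R : realType} {n : nat} {M : topologicalType} {A : charted 'rV[R]_n M}.
Hypothesis HM : smooth_manifold A.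
Implicit Types (c d : chart A) (x : M).
Local Notation TM := {x : M & tangent A x}.
Local Notation TA := (tangent_bundle A).
Local Notation T2M := {z : TM & tangent TA z}.

Lemma smooth_transition c d x : dom c x -> dom d x ->
  smooth_near (coord d \o inv_coord c x) (coord c x).
Proof. by case: HM => _ _ _ _; apply. Qed.

Lemma open_dom c : open (dom c).
Proof. by case: HM => _ _ _ /(_ c)[]. Qed.

Lemma open_coord_image c (V : set M) : open V -> V `<=` dom c -> open (coord c @` V).
Proof. by case: HM => _ _ _ /(_ c)[_ _ _ H] _; exact: H. Qed.

Lemma coord_injective c x x' : dom c x -> dom c x' -> coord c x = coord c x' -> x = x'.
Proof.
case: HM => _ _ _ /(_ c)[_ ci _ _] _ cx cx'.
by apply: ci; rewrite inE.
Qed.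

Lemma continuous_coord c x : dom c x -> {for x, continuous (coord c)}.
Proof. by case: HM => _ _ _ /(_ c)[_ _ H _] _; exact: H. Qed.

Lemma chart_at x : exists c, dom c x.
Proof. by case: HM => _ _ H _ _; exact: H. Qed.

Lemma near_coord_image c x (V : set M) : open V -> V x -> dom c x ->
  \forall p \near coord c x, exists x', [/\ V x', dom c x' & coord c x' = p].
Proof.
move=> oV Vx cx.
have : nbhs (coord c x) (coord c @` (V `&` dom c)).
  apply: open_nbhs_nbhs; split; last by exists x.
  by apply: open_coord_image => [|? []//]; apply: openI => //; exact: open_dom.
by apply: filterS => p [x' [Vx' cx'] <-]; exists x'.
Qed.

Lemma manifold_atlas : atlas A.
Proof.
split=> [c x x'|c x cx|c d x cx dx]; first exact: coord_injective.
  by apply: filterS (near_coord_image openT I cx) => p [x' [_ ? ?]]; exists x'.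
exists (coord d \o inv_coord c x).
  exact: smooth_near_differentiable (smooth_transition cx dx).
apply: filterS (near_coord_image (open_dom d) dx cx) => p [x1 [dx1 cx1 <-]] x2 cx2 cE.
have -> : x2 = x1 by exact: coord_injective cE.
split=> //=; congr (coord d _).
rewrite /inv_coord; case: xgetP => [y _ [cy /coord_injective -> //]|/(_ x1) H].
by case: H.
Qed.
Let HA := manifold_atlas.

Lemma near_inv_coord_open c x y (V : set M) : open V -> V x -> dom c x ->
  \forall p \near coord c x, V (inv_coord c y p).
Proof.
move=> oV Vx cx; apply: filterS (near_coord_image oV Vx cx) => p [x' [Vx' cx' <-]].
by rewrite (coordK HA).
Qed.

Lemma tangent_trans_at c d x y (v : tangent A x) : dom c x -> dom d x ->
  v d = 'd (coord d \o inv_coord c y) (coord c x) (v c).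
Proof.
move=> cx dx; apply: etrans (tangent_trans v cx dx) _.
exact: diff_transition_default.
Qed.

Lemma differentiable_diff_transition c d x v : dom c x -> dom d x ->
  differentiable (fun u => 'd (coord d \o inv_coord c x) u v) (coord c x).
Proof.
move=> cx dx.
exact/smooth_near_differentiable/smooth_near_diff/smooth_transition.
Qed.

Definition tangent_transition c d x (p : 'rV[R]_n * 'rV[R]_n) :=
  ((coord d \o inv_coord c x) p.1, 'd (coord d \o inv_coord c x) (p.1) p.2).

(** The differential of [tangent_transition] at [(coord c x, v)]. Its last term, a second
    derivative, is why the component V of a point of T^2M is not a vector by itself. *)
Definition diff_tangent_transition c d x (v : 'rV[R]_n) (h : 'rV[R]_n * 'rV[R]_n) :=
  ('d (coord d \o inv_coord c x) (coord c x) h.1,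
   'd (coord d \o inv_coord c x) (coord c x) h.2 +
   'd (fun u => 'd (coord d \o inv_coord c x) u v) (coord c x) h.1).

Lemma is_diff_tangent_transition c d x v : dom c x -> dom d x ->
  is_diff (coord c x, v) (tangent_transition c d x) (diff_tangent_transition c d x v).
Proof.
move=> cx dx.
have D1 := is_diff_fst (coord c x, v); have D2 := is_diff_snd (coord c x, v).
have T := differentiableP (smooth_near_differentiable (smooth_transition cx dx)).
have P := @is_diff_diff_app R _ _ _ _ _ _ _ _ _
  (fun v => differentiable_diff_transition v cx dx) D1 D2.
exact: (is_diff_pair (is_diff_comp_at D1 erefl T) P).
Qed.

Lemma near_tangent_transition c d (z : TM) : dom c (tag z) -> dom d (tag z) ->
  \forall p \near (coord c (tag z), tagged z c), forall z' : TM, dom c (tag z') ->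
    coord (c := TA) c z' = p ->
    dom d (tag z') /\ coord (c := TA) d z' = tangent_transition c d (tag z) p.
Proof.
move=> cz dz.
have N : \forall p \near (coord c (tag z), tagged z c),
    dom d (inv_coord c (tag z) p.1).
  exact: (cvg_fst (near_inv_coord_open (tag z) (open_dom d) dz cz)).
apply: filterS N => p dp [x' v'] /= cx' pE.
have cE : coord c x' = p.1 by rewrite -pE.
have dx' : dom d x' by move: dp; rewrite -cE (coordK HA).
split=> //; rewrite /tangent_transition -pE /= (coordK HA)//; congr pair.
exact: tangent_trans_at.
Qed.

Lemma near_tangent_image c (z : TM) : dom c (tag z) ->
  \forall p \near (coord c (tag z), tagged z c),
    exists2 z' : TM, dom c (tag z') & (coord c (tag z'), tagged z' c) = p.
Proof.
move=> cz.
have N : \forall p \near (coord c (tag z), tagged z c),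
    exists x', [/\ setT x', dom c x' & coord c x' = p.1].
  exact: (cvg_fst (near_coord_image openT I cz)).
apply: filterS N => p [x' [_ cx' pE]].
have [v' v'E] := tangent_ex HA p.2 cx'.
by exists (existT (tangent A) x' v') => //=; rewrite pE v'E; case: p {pE v'E}.
Qed.

Lemma tangent_bundle_inj c (z z' : TM) : dom c (tag z) -> dom c (tag z') ->
  coord c (tag z) = coord c (tag z') -> tagged z c = tagged z' c -> z = z'.
Proof.
case: z z' => [x v] [x' v'] /= cx cx' xx'; have {}xx' := coord_injective cx cx' xx'.
by subst x' => vv'; congr existT; exact: tangent_at_inj cx vv'.
Qed.

Lemma tangent_bundle_atlas : atlas TA.
Proof.
split=> [c z z' cz cz' []|c z|c d z cz dz].
- exact: tangent_bundle_inj.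
- exact: near_tangent_image.
- exists (tangent_transition c d (tag z)); last exact: near_tangent_transition.
  exact: is_diff_differentiable (is_diff_tangent_transition (tagged z c) cz dz).
Qed.
Let HTA := tangent_bundle_atlas.

Lemma diff_tangent_bundle_transition c d (z : TM) h : dom c (tag z) -> dom d (tag z) ->
  'd (coord (c := TA) d \o inv_coord (A := TA) c z) (coord (c := TA) c z) h =
  diff_tangent_transition c d (tag z) (tagged z c) h.
Proof.
move=> cz dz.
have D := is_diff_tangent_transition (tagged z c) cz dz.
suff N : \forall p \near (coord c (tag z), tagged z c),
    tangent_transition c d (tag z) p =
    (coord (c := TA) d \o inv_coord (A := TA) c z) p.
  exact: (is_diffE (near_eq_is_diff N D) h).
apply: filterS2 (near_tangent_transition cz dz) (near_inv_coord HTA (c := c) z cz) => p.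
by move=> H [cp pE]; have [_ <-] := H _ cp pE.
Qed.

Lemma t2_transition c d (Z : T2M) : dom c (t2_base Z) -> dom d (t2_base Z) ->
  tagged Z d = diff_tangent_transition c d (t2_base Z) (tagged (tag Z) c) (tagged Z c).
Proof.
case: Z => z w cz dz; rewrite -diff_tangent_bundle_transition//.
exact: (tangent_trans w cz dz).
Qed.

Lemma t2coordE c (Z : T2M) :
  t2coord c Z = ((coord c (t2_base Z), tagged (tag Z) c), tagged Z c).
Proof. by []. Qed.

Lemma t2coord_inj c (Z Z' : T2M) : dom c (t2_base Z) -> dom c (t2_base Z') ->
  t2coord c Z = t2coord c Z' -> Z = Z'.
Proof.
case: Z Z' => [z w] [z' w'] cz cz'; rewrite !t2coordE /= => -[E1 E2 E3].
have zz' : z = z' by exact: (tangent_bundle_inj (c := c)).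
subst z'; congr existT; apply: (@tangent_at_inj R _ _ TA z w w' c) => //.
Qed.

Lemma t2_ex c x (v a b : 'rV[R]_n) : dom c x ->
  exists2 Z : T2M, t2_base Z = x & t2coord c Z = ((coord c x, v), (a, b)).
Proof.
move=> cx; have [X XE] := tangent_ex HA v cx.
have [w wE] := tangent_ex (x := existT (tangent A) x X) HTA (c := c) (a, b) cx.
by exists (existT _ (existT _ x X) w) => //; rewrite t2coordE /= XE wE.
Qed.

(** The swap is performed in one chart; it agrees with the swap in any other because the
    second-derivative term of the transition is symmetric in the two vectors. *)
Lemma t2_kappaP (Z : T2M) : t2_base (t2_kappa Z) = t2_base Z /\
  forall c, dom c (t2_base Z) -> t2coord c (t2_kappa Z) =
    ((coord c (t2_base Z), (t2coord c Z).2.1), ((t2coord c Z).1.2, (t2coord c Z).2.2)).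
Proof.
rewrite /t2_kappa; case: xgetP => [//|H].
have [c cz] := chart_at (t2_base Z).
have [Z' bZ' Z'E] := t2_ex (t2coord c Z).2.1 (t2coord c Z).1.2 (t2coord c Z).2.2 cz.
case: (H Z'); split => // d dz.
have [cz' dz'] : dom c (t2_base Z') /\ dom d (t2_base Z') by rewrite bZ'.
have TZ := t2_transition cz dz; have TZ' := t2_transition cz' dz'.
rewrite !t2coordE /= in Z'E *.
have [E1 E2 E3] : [/\ coord c (t2_base Z') = coord c (t2_base Z),
  tagged (tag Z') c = (tagged Z c).1 & tagged Z' c = (tagged (tag Z) c, (tagged Z c).2)].
  by case: Z'E.
have X'd := tangent_trans_at (t2_base Z) (tagged (tag Z')) cz' dz'.
have Xd := tangent_trans_at (t2_base Z) (tagged (tag Z)) cz dz.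
rewrite TZ TZ' bZ' E2 E3 /diff_tangent_transition /=.
rewrite E1 E2 in X'd; rewrite X'd Xd.
do 2!congr pair; congr (_ + _).
apply: schwarz_mx => [|v]; last exact: differentiable_diff_transition.
by apply: filterS (smooth_near_near (smooth_transition cz dz)) => u /smooth_near_differentiable.
Qed.

(** The second-derivative term of the transition depends only on the images under [p] and [p_*], so
    it cancels in the difference and one chart determines the vector. *)
Lemma t2_piE c (Z1 Z2 : T2M) (w : tangent A (t2_base Z1)) : dom c (t2_base Z1) ->
  t2_p Z1 = t2_p Z2 -> (t2coord c Z1).2.1 = (t2coord c Z2).2.1 ->
  w c = (t2coord c Z1).2.2 - (t2coord c Z2).2.2 ->
  t2_pi Z1 Z2 = existT (tangent A) (t2_base Z1) w.
Proof.
move=> cz pE YE wE; rewrite /t2_pi; congr existT.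
have bE : t2_base Z2 = t2_base Z1 by rewrite /t2_base -[tag Z2]pE.
have H d : dom d (t2_base Z1) -> w d = (t2coord d Z1).2.2 - (t2coord d Z2).2.2.
  move=> dz; rewrite !t2coordE /= in YE wE *.
  have XE : tagged (tag Z1) c = tagged (tag Z2) c by rewrite [tag Z1]pE.
  rewrite (t2_transition cz dz) (@t2_transition c d Z2) ?bE//.
  rewrite (tangent_trans w cz dz) wE /diff_tangent_transition /= -YE -XE.
  rewrite opprD addrACA subrr addr0; exact: linearB.
case: xgetP => [w' _ /= w'E|/(_ w)]; last by case.
by apply: (tangent_at_inj cz); rewrite w'E// H.
Qed.

Lemma t2_pstarE c (Z : T2M) : dom c (t2_base Z) ->
  tagged (t2_pstar Z) c = (t2coord c Z).2.1.
Proof.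
move=> cz; rewrite /t2_pstar /=.
have L : \forall p \near coord (c := TA) c (tag Z),
    p.1 = local_expr (A := TA) (B := A) (fun z : TM => tag z) (tag Z) c c p.
  by apply: filterS (near_inv_coord HTA (c := c) (tag Z) cz) => p [_ {1}<-].
have D := near_eq_is_diff L (is_diff_fst _).
rewrite (@tdiffE _ _ _ _ _ TA A HTA HA _ _ _ c c)//; first exact: (is_diffE D).
exists c, c; split => //.
by apply: filterS (near_inv_coord HTA (c := c) (tag Z) cz) => p [].
Qed.

End Manifold.

(** * Bisections in charts *)

Section Bisections.
Context {R : realType} {n : nat} {M : topologicalType} {A : charted 'rV[R]_n M}.
Hypothesis HM : smooth_manifold A.
Implicit Types (c d : chart A) (x y : M).
Local Notation TM := {x : M & tangent A x}.
Let HA := manifold_atlas HM.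

Lemma tvecE c x v : dom c x -> (tvec c x v : tangent A x) c = v.
Proof.
move=> cx; rewrite /tvec; case: xgetP => [//|H].
by have [w /H] := tangent_ex HA v cx.
Qed.

Lemma tvecK c x (v : tangent A x) : dom c x -> tvec c x (v c) = v.
Proof. by move=> cx; apply: (tangent_at_inj cx); rewrite tvecE. Qed.

Lemma tvec_linear c x : dom c x -> linear (tvec c x : 'rV[R]_n -> tangent A x).
Proof.
move=> cx a v w; apply: (tangent_at_inj cx).
by rewrite tangentD tangentZ !tvecE.
Qed.

Lemma mul_rV_lin1_fun p q (f : 'rV[R]_p -> 'rV[R]_q) u : linear f -> u *m lin1_mx f = f u.
Proof.
move=> fl; pose L : {linear 'rV[R]_p -> 'rV[R]_q} :=
  HB.pack f (GRing.isLinear.Build R _ _ _ _ fl).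
exact: (mul_rV_lin1 L).
Qed.

Lemma linear_mulmx_comp p q r k (g : {linear 'rV[R]_p -> 'rV[R]_q})
  (h : {linear 'rV[R]_k -> 'rV[R]_r}) (B : 'M[R]_(r, p)) :
  linear (fun w => g (h w *m B)).
Proof. by move=> a v w; rewrite linearP mulmxDl -scalemxAl linearP. Qed.

Lemma iso_mxE x y (xi : tiso A x y) c d (v : tangent A x) : dom c x ->
  (xi v) d = v c *m iso_mx xi c d.
Proof.
move=> cx; rewrite mul_rV_lin1_fun ?tvecK//.
by move=> a u w; rewrite tvec_linear// linearP tangentD tangentZ.
Qed.

Lemma iso_mx_unit x y (xi : tiso A x y) c d : dom c x -> dom d y ->
  iso_mx xi c d \in unitmx.
Proof.
move=> cx dy; rewrite -row_free_unit -kermx_eq0.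
apply/rowV0P => v /sub_kermxP vk.
have [g gK _] := iso_bij xi.
have : xi (tvec c x v) = 0.
  by apply: (tangent_at_inj dy); rewrite (iso_mxE _ _ _ cx) tvecE// vk.
move=> /(congr1 g); rewrite gK -(linear0 xi) gK => /(congr1 (fun w : tangent A x => w c)).
by rewrite tvecE.
Qed.

Lemma iso_mx_transition x y (xi : tiso A x y) c d c' d' x0 y0 :
  dom c x -> dom c' x -> dom d y -> dom d' y ->
  iso_mx xi c' d' = lin1_mx (fun w => 'd (coord d' \o inv_coord d y0) (coord d y)
     ('d (coord c \o inv_coord c' x0) (coord c' x) w *m iso_mx xi c d)).
Proof.
move=> cx c'x dy d'y; congr lin1_mx; apply/funext => w.
rewrite (tangent_trans_at HM y0 _ dy d'y) (iso_mxE _ _ _ cx).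
by rewrite (tangent_trans_at HM x0 _ c'x cx) tvecE.
Qed.

(** The matrix of an isomorphism changes by differentials of the chart changes taken at moving
    points, so second derivatives of the transition maps enter. *)
Lemma B1_compatible : compatible (B1_charted A).
Proof.
move=> [c d] [c' d'] [x [y xi]] /= [cx dy] [c'x d'y].
pose tau := coord c' \o inv_coord c x.
pose tau' := coord c \o inv_coord c' x.
pose sigma := coord d' \o inv_coord d y.
(* The inverse of the differential of [tau] is written as the differential of [tau'] at [tau p.1],
   so that no matrix has to be inverted. *)
pose f (p : 'rV[R]_n * ('rV[R]_n * 'M[R]_n)) w :=
  'd sigma (p.2.1) ('d tau' (tau p.1) w *m p.2.2).
pose p0 := (coord c x, (coord d y, iso_mx xi c d)).
exists (fun p => (tau p.1, (sigma p.2.1, lin1_mx (f p)))).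
- have D1 := is_diff_fst p0; have D2 := is_diff_snd p0.
  have D21 := is_diff_comp_at D2 erefl (is_diff_fst p0.2).
  have D22 := is_diff_comp_at D2 erefl (is_diff_snd p0.2).
  have Dtau := differentiableP (smooth_near_differentiable (smooth_transition HM cx c'x)).
  have Dsigma := differentiableP (smooth_near_differentiable (smooth_transition HM dy d'y)).
  have P1 := is_diff_comp_at D1 erefl Dtau.
  have P2 := is_diff_comp_at D21 erefl Dsigma.
  have Et : tau p0.1 = coord c' x by rewrite /tau /p0/= (coordK HA).
  have Df w : differentiable (f ^~ w) p0.
    have T := differentiableP (differentiable_diff_transition HM w c'x cx).
    have Q := is_diff_mulmx (is_diff_comp_at P1 Et T) D22.
    have S := @is_diff_diff_app R _ _ _ _ _ _ _ _ p0
      (fun v => differentiable_diff_transition HM v dy d'y) D21 Q.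
    exact: is_diff_differentiable S.
  apply: differentiable_pair; first exact: is_diff_differentiable P1.
  apply: differentiable_pair; first exact: is_diff_differentiable P2.
  apply: differentiable_rows => w.
  have -> : (fun u => w *m lin1_mx (f u)) = f ^~ w.
    apply/funext => u; apply: mul_rV_lin1_fun; exact: linear_mulmx_comp.
  exact: Df.
- have N1 : \forall p \near p0, dom c' (inv_coord c x p.1).
    exact: (cvg_fst (near_inv_coord_open HM x (open_dom HM c') c'x cx)).
  have N2 : \forall p \near p0.2, dom d' (inv_coord d y p.1).
    exact: (cvg_fst (near_inv_coord_open HM y (open_dom HM d') d'y dy)).
  have {}N2 : \forall p \near p0, dom d' (inv_coord d y p.2.1) by exact: (cvg_snd N2).
  apply: filterS2 N1 N2 => p c'p d'p [x' [y' xi']] /= [cx' dy'] pE.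
  move: c'p d'p; rewrite -pE /= !(coordK HA)// => c'x' d'y'.
  split=> //; rewrite /tau /sigma /= !(coordK HA)//; congr (_, (_, _)).
  rewrite (iso_mx_transition _ x y cx' c'x' dy' d'y') /f /= /tau /= (coordK HA)//.
Qed.

Section OneBisection.
Variables (b : bisection A) (x y : M) (xi : tiso A x y) (c d : chart A).
Hypotheses (bx : bis_dom b x) (bxi : b x = existT (tiso A x) y xi).
Hypotheses (cx : dom c x) (dy : dom d y).

Definition bis_phi (b' : bisection A) u := coord d (bis0 b' (inv_coord c x u)).
Definition bis_mx (b' : bisection A) u := iso_mx (tagged (b' (inv_coord c x u))) c d.

Lemma bis0E : bis0 b x = y. Proof. by rewrite /bis0 bxi. Qed.

Lemma bis_phi_at : bis_phi b (coord c x) = coord d y.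
Proof. by rewrite /bis_phi (coordK HA)// bis0E. Qed.

Lemma bis_mx_at : bis_mx b (coord c x) = iso_mx xi c d.
Proof. by rewrite /bis_mx (coordK HA)// bxi. Qed.

Lemma bis_pt_diff_at : diff_at (A := A) (B := B1_charted A) (bis_pt b) x.
Proof. exact: smooth_at_diff_at (bis_smooth bx). Qed.

Let B1dom : @dom _ _ _ (B1_charted A) (c, d) (bis_pt b x).
Proof. by rewrite /= bxi. Qed.

Lemma bis_near : \forall u \near coord c x,
  [/\ bis_dom b (inv_coord c x u), dom c (inv_coord c x u) & dom d (bis0 b (inv_coord c x u))].
Proof.
have [N _] := diff_at_charts HA B1_compatible bis_pt_diff_at cx B1dom.
have [ob _ _ _] := bis_diffeo b.
apply: filterS2 N (near_inv_coord_open HM x ob bx cx) => u [? ?] ?.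
by split.
Qed.

Lemma bis_local_differentiable :
  differentiable (bis_phi b) (coord c x) /\ differentiable (bis_mx b) (coord c x).
Proof.
have [_ /differentiableP D] := diff_at_charts HA B1_compatible bis_pt_diff_at cx B1dom.
have D2 := is_diff_comp_at D erefl (is_diff_snd _).
split.
  exact: is_diff_differentiable (is_diff_comp_at D2 erefl (is_diff_fst _)).
exact: is_diff_differentiable (is_diff_comp_at D2 erefl (is_diff_snd _)).
Qed.

Lemma bis_local_expr_is_diff :
  is_diff (coord c x) (local_expr (A := A) (B := B1_charted A) (bis_pt b) x c (c, d))
    (fun h => (h, ('d (bis_phi b) (coord c x) h, 'd (bis_mx b) (coord c x) h))).
Proof.
have [/differentiableP D1 /differentiableP D2] := bis_local_differentiable.
have D0 : is_diff (coord c x) (fun u => coord c (inv_coord c x u)) id.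
  apply: near_eq_is_diff (is_diff_id _).
  by apply: filterS (near_inv_coord HA x cx) => u [_ ->].
exact: is_diff_pair D0 (is_diff_pair D1 D2).
Qed.

(** The equation is placed in the total space because [bis0 b x] and [y] are equal only
    propositionally. *)
Lemma tdiff_bis0 (v : tangent A x) (w : tangent A y) :
  existT (tangent A) y w = existT (tangent A) (bis0 b x) (tdiff A A (bis0 b) v) <->
  w d = 'd (bis_phi b) (coord c x) (v c).
Proof.
have [_ sb _ _] := bis_diffeo b.
have db := smooth_at_diff_at (sb x bx).
have dy' : dom d (bis0 b x) by rewrite bis0E.
have L := tdiffE HA HA v db cx dy'.
split=> [E|E].
  rewrite -[RHS]L.
  exact: (congr1 (fun z : {x & tangent A x} => tagged z d) E).
apply: (@tangent_bundle_inj _ _ _ _ HM d) => //=; first by rewrite bis0E.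
by rewrite L.
Qed.

Lemma bis0_inj x1 x2 : bis_dom b x1 -> bis_dom b x2 -> bis0 b x1 = bis0 b x2 -> x1 = x2.
Proof.
move=> b1 b2 E; have [_ _ _ [g gP]] := bis_diffeo b.
by rewrite -(gP _ b1).1 -(gP _ b2).1; congr g.
Qed.

Lemma push_bis0 (Y : vfield) x1 : bis_dom b x1 ->
  existT (tangent A) _ (push b Y (bis0 b x1)) = bis_mul b (existT (tangent A) _ (Y x1)).
Proof.
move=> b1; rewrite /push; case: xgetP => [w _ [x2 b2 E]|H].
  have x21 := bis0_inj b1 b2 (congr1 (fun z : {x & tangent A x} => tag z) E).
  by rewrite -x21 in E.
by case: (H (tagged (b x1) (Y x1))); exists x1.
Qed.

Lemma bis_mul_at (w : tangent A x) :
  bis_mul b (existT (tangent A) x w) = existT (tangent A) y (xi w).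
Proof. by rewrite /bis_mul /bis0 /= bxi. Qed.

Lemma push_at (Y : vfield) : push b Y y = xi (Y x).
Proof.
have := push_bis0 Y bx; rewrite bis_mul_at bis0E => E.
by apply: (tangent_at_inj dy); move/(congr1 (fun z : {x & tangent A x} => tagged z d)): E.
Qed.

Definition vfield_coord (c' : chart A) (x' : M) (Y : vfield) u : 'rV[R]_n :=
  Y (inv_coord c' x' u) c'.

(** In charts the pushed field is the product of [Y] and the matrix of [b], composed with the local
    inverse [psi] of the base map. Along directions of the form ['d (bis_phi b) h] the differential
    of [psi] cancels and the plain product rule remains. *)
Lemma push_is_diff (Y : vfield) : differentiable (vfield_coord c x Y) (coord c x) ->
  differentiable (vfield_coord d y (push b Y)) (coord d y) /\
  forall h, 'd (vfield_coord d y (push b Y)) (coord d y) ('d (bis_phi b) (coord c x) h) =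
    'd (vfield_coord c x Y) (coord c x) h *m iso_mx xi c d +
    Y x c *m 'd (bis_mx b) (coord c x) h.
Proof.
move=> /differentiableP DY.
have [ob _ oim [g gP]] := bis_diffeo b.
have [gx sg] := gP x bx.
rewrite -[tag (b x)]/(bis0 b x) bis0E in gx sg.
have gyx : dom c (g y) by rewrite gx.
have [Nc /differentiableP Dg] :=
  diff_at_charts HA (atlas_compatible HA) (smooth_at_diff_at sg) dy gyx.
have [/differentiableP Dphi /differentiableP Dmx] := bis_local_differentiable.
pose psi := local_expr g y d c.
have psi_at : psi (coord d y) = coord c x by rewrite /psi local_expr_at// gx.
have key : \forall v \near coord d y,
    vfield_coord c x Y (psi v) *m bis_mx b (psi v) = vfield_coord d y (push b Y) v.
  have yim : (bis0 b @` bis_dom b) y by exists x => //; rewrite bis0E.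
  apply: filterS2 Nc (near_inv_coord_open HM y oim yim dy) => v + [x1 b1 E].
  have [g1 _] := gP x1 b1; rewrite -[tag (b x1)]/(bis0 b x1) in g1.
  rewrite /vfield_coord /bis_mx /psi /local_expr -E g1 => cx1.
  rewrite (coordK HA)//.
  have /(congr1 (fun z : {x & tangent A x} => tagged z d)) /= -> := push_bis0 Y b1.
  exact/esym/iso_mxE.
have D := is_diff_mulmx (is_diff_comp_at Dg psi_at DY) (is_diff_comp_at Dg psi_at Dmx).
have {}D := near_eq_is_diff key D.
split=> [|h]; first exact: is_diff_differentiable D.
have inv : 'd psi (coord d y) ('d (bis_phi b) (coord c x) h) = h.
  have P := is_diff_comp_at Dphi bis_phi_at Dg.
  apply: (etrans (esym (is_diffE P h))).
  have N : \forall u \near coord c x, u = local_expr g y d c (bis_phi b u).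
    apply: filterS2 bis_near (near_inv_coord HA x cx) => u [bu cu du] [_ uE].
    have [gu _] := gP _ bu; rewrite -[tag _]/(bis0 b (inv_coord c x u)) in gu.
    by rewrite /local_expr /bis_phi (coordK HA)// gu uE.
  by rewrite (is_diffE (near_eq_is_diff N (is_diff_id _))).
apply: etrans (is_diffE D ('d (bis_phi b) (coord c x) h)) _.
have mE : bis_mx b (psi (coord d y)) = iso_mx xi c d by rewrite psi_at bis_mx_at.
have YE : vfield_coord c x Y (psi (coord d y)) = Y x c.
  by rewrite psi_at /vfield_coord (coordK HA).
congr (_ + _).
  exact: (congr2 mulmx (congr1 ('d (vfield_coord c x Y) (coord c x)) inv) mE).
exact: (congr2 mulmx YE (congr1 ('d (bis_mx b) (coord c x)) inv)).
Qed.

End OneBisection.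

(** The source coordinate contributes the identity to both differentials, so only the base map and
    the matrix have to be compared, in one pair of charts. *)
Lemma same_jet1_bisP (b b' : bisection A) x y (xi : tiso A x y) c d :
  bis_dom b x -> bis_dom b' x -> b x = existT (tiso A x) y xi ->
  b' x = existT (tiso A x) y xi -> dom c x -> dom d y ->
  same_jet1 A (B1_charted A) (bis_pt b) (bis_pt b') x <->
  'd (bis_phi x c d b) (coord c x) =1 'd (bis_phi x c d b') (coord c x) /\
  'd (bis_mx x c d b) (coord c x) =1 'd (bis_mx x c d b') (coord c x).
Proof.
move=> bx b'x bxi b'xi cx dy.
have D := bis_local_expr_is_diff bx bxi cx dy.
have D' := bis_local_expr_is_diff b'x b'xi cx dy.
have E : bis_pt b x = bis_pt b' x by rewrite /bis_pt bxi b'xi.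
have dB : @dom _ _ _ (B1_charted A) (c, d) (bis_pt b x) by rewrite /= bxi.
split=> [[_ H]|[H1 H2]].
  have K h := H c (c, d) cx dB h.
  have KE h := etrans (esym (is_diffE D h)) (etrans (K h) (is_diffE D' h)).
  split=> h; first exact: (congr1 (fun p => p.2.1) (KE h)).
  exact: (congr1 (fun p => p.2.2) (KE h)).
apply: (same_jet1_charts HA B1_compatible E cx dB).
- exact: bis_pt_diff_at.
- exact: bis_pt_diff_at.
- move=> h; apply: etrans (is_diffE D h) (etrans _ (esym (is_diffE D' h))).
  exact: (congr2 pair erefl (congr2 pair (H1 h) (H2 h))).
Qed.

End Bisections.

(** * Brackets, the connection and its torsion *)

Section Connections.
Context {R : realType} {n : nat} {M : topologicalType} {A : charted 'rV[R]_n M}.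
Hypothesis HM : smooth_manifold A.
Implicit Types (c d : chart A) (x y : M) (X Y : @vfield R n M A).
Let HA := manifold_atlas HM.

Lemma near_eq_near (V : normedModType R) (W : Type) (f g : V -> W) (x : V) :
  (\forall u \near x, f u = g u) -> \forall u \near x, \forall u' \near u, f u' = g u'.
Proof. by move=> /nbhs_interior. Qed.

(* ['d] depends on its base point through a phantom argument, so that base
   points cannot be rewritten inside an applied differential. *)
Lemma diff_point (V W : normedModType R) (F : V -> W) (u v h : V) :
  u = v -> 'd F u h = 'd F v h.
Proof. by move=> ->. Qed.

(** Smoothness is given in some unspecified chart [c0]; what is carried over to [c] is exactly what
    [schwarz] asks for. *)
Lemma smooth_function_at (f : M -> R^o) c x : smooth_at A (self_charted R^o) f x -> dom c x ->
  (\forall u \near coord c x, differentiable (f \o inv_coord c x) u) /\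
  forall v, differentiable (fun u => 'd (f \o inv_coord c x) u v : R^o) (coord c x).
Proof.
move=> [c0 [e [c0x _ _ sF]]] cx.
pose F := local_expr (B := self_charted R^o) f x c0 e.
pose tau := coord c0 \o inv_coord c x.
have st := smooth_transition HM cx c0x.
have tauE : tau (coord c x) = coord c0 x by rewrite /tau /= (coordK HA).
have fE : \forall u \near coord c x, F (tau u) = (f \o inv_coord c x) u.
  apply: filterS (near_inv_coord_open HM x (open_dom HM c0) c0x cx) => u c0u.
  by rewrite /F /tau /local_expr /= (coordK HA).
have ct : tau u @[u --> coord c x] --> coord c0 x.
  by rewrite -tauE; exact: differentiable_continuous (smooth_near_differentiable st).
have D : \forall u \near coord c x,
    is_diff u (f \o inv_coord c x) (fun h => 'd F (tau u) ('d tau u h)).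
  have N : \forall u \near coord c x, smooth_near F (tau u).
    exact: ct _ (smooth_near_near sF).
  apply: filterS3 N (smooth_near_near st) (near_eq_near fE) => u sFu stu fEu.
  apply: near_eq_is_diff fEu _.
  exact: is_diff_comp_at (differentiableP (smooth_near_differentiable stu)) erefl
    (differentiableP (smooth_near_differentiable sFu)).
split=> [|v]; first by apply: filterS D => u /is_diff_differentiable.
have N : \forall u \near coord c x,
    'd F (tau u) ('d tau u v) = 'd (f \o inv_coord c x) u v.
  by apply: filterS D => u Du; exact: (esym (is_diffE Du v)).
have Dtau := differentiableP (smooth_near_differentiable st).
have Dtauv := differentiableP (smooth_near_differentiable (smooth_near_diff v st)).
have dF w : differentiable (fun u => 'd F u w) (tau (coord c x)).
  rewrite tauE; exact: smooth_near_differentiable (smooth_near_diff w sF).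
have Q := is_diff_diff_app dF Dtau Dtauv.
exact: is_diff_differentiable (near_eq_is_diff N Q).
Qed.

Lemma vderE c x (v : tangent A x) (f : M -> R^o) : dom c x ->
  differentiable (f \o inv_coord c x) (coord c x) ->
  vder v f = 'd (f \o inv_coord c x) (coord c x) (v c).
Proof.
move=> cx df.
have dfx : diff_at (A := A) (B := self_charted R^o) f x.
  by exists c, tt; split => //; near=> u.
rewrite /vder; case: xgetP => [r _ /(_ c cx)//|/= H].
case: (H ('d (f \o inv_coord c x) (coord c x) (v c))) => c' c'x.
rewrite (tangent_trans v cx c'x).
have := diff_local_expr_transition HA (self_atlas R^o) (e := tt) (e' := tt) (v c) cx c'x I I dfx.
move=> E; apply: etrans _ (esym E).
exact/esym/(diff_transition_id (self_atlas R^o)).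
Unshelve. all: by end_near. Qed.

Lemma vder_vder c x X Y (f : M -> R^o) : smooth_at A (self_charted R^o) f x -> dom c x ->
  differentiable (vfield_coord c x Y) (coord c x) ->
  vder (X x) (fun x' => vder (Y x') f) =
    'd (f \o inv_coord c x) (coord c x) ('d (vfield_coord c x Y) (coord c x) (X x c)) +
    'd (fun u => 'd (f \o inv_coord c x) u (Y x c) : R^o) (coord c x) (X x c).
Proof.
move=> sf cx /differentiableP DY.
have [df1 df2] := smooth_function_at sf cx.
have N : \forall u \near coord c x,
    'd (f \o inv_coord c x) u (vfield_coord c x Y u) =
    ((fun x' => vder (Y x') f) \o inv_coord c x) u.
  apply: filterS2 df1 (near_inv_coord HA x cx) => u dfu [cu uE] /=.
  have dfu' : differentiable (f \o inv_coord c x) (coord c (inv_coord c x u)).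
    by rewrite uE.
  have L : \forall u' \near coord c (inv_coord c x u),
      (f \o inv_coord c x) u' = (f \o inv_coord c (inv_coord c x u)) u'.
    by apply: filterS (near_inv_coord_default HA x (inv_coord c x u) cu) => u' /= ->.
  have [dg dgE] := near_eq_diff L dfu'.
  apply/esym; apply: etrans (vderE _ cu dg) _.
  apply: etrans (congr1 (fun g => g (Y (inv_coord c x u) c)) dgE) _.
  exact: diff_point.
have D := near_eq_is_diff N (is_diff_diff_app df2 (is_diff_id _) DY).
rewrite (vderE _ cx (is_diff_differentiable D)).
apply: etrans (is_diffE D _) _.
by rewrite {2}/vfield_coord (coordK HA).
Qed.

Lemma coord_function_smooth c x i : dom c x ->
  smooth_at A (self_charted R^o) (fun x' => coord c x' 0 i : R^o) x /\
  forall v : tangent A x, vder v (fun x' => coord c x' 0 i) = v c 0 i.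
Proof.
move=> cx.
have N : \forall u \near coord c x, ((u : 'rV[R]_n) 0 i : R^o) = coord c (inv_coord c x u) 0 i.
  by apply: filterS (near_inv_coord HA x cx) => u [_ {1}<-].
have D (u : 'rV[R]_n) : is_diff u (fun u : 'rV[R]_n => u 0 i : R^o) (fun h : 'rV[R]_n => h 0 i).
  exact: is_diff_coord (is_diff_id u).
split.
  exists c, tt; split => //; first by near=> u.
  apply: smooth_near_eq N _; exists setT => [|k]; first by split => //; exact: openT.
  exact: (Ck_affine k openT D).
move=> v; have D' := near_eq_is_diff N (D _).
rewrite (vderE _ cx (is_diff_differentiable D')).
exact: is_diffE D' _.
Unshelve. all: by end_near. Qed.

(** The second-order terms of the two iterated derivations cancel by [schwarz], which shows that a
    vector as required exists. Testing on the coordinate functions of [c] shows that it is the only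
    one. *)
Lemma bracketE c x X Y : dom c x ->
  differentiable (vfield_coord c x X) (coord c x) ->
  differentiable (vfield_coord c x Y) (coord c x) ->
  bracket X Y x c = 'd (vfield_coord c x Y) (coord c x) (X x c) -
                    'd (vfield_coord c x X) (coord c x) (Y x c).
Proof.
move=> cx dX dY.
set v := _ - _; have [w wE] := tangent_ex HA v cx.
have H (f : M -> R^o) : smooth_at A (self_charted R^o) f x ->
    vder w f = vder (X x) (fun x' => vder (Y x') f)
             - vder (Y x) (fun x' => vder (X x') f).
  move=> sf; rewrite (vder_vder _ sf cx dY) (vder_vder _ sf cx dX).
  have [df1 df2] := smooth_function_at sf cx.
  have dfx : differentiable (f \o inv_coord c x) (coord c x) by exact: nbhs_singleton df1.
  rewrite (vderE _ cx dfx) wE /v opprD addrACA.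
  rewrite [X in _ = _ + (_ - X)](schwarz df1 (df2 (X x c)) (df2 (Y x c))) subrr addr0.
  exact: linearB.
rewrite /bracket; case: xgetP => [w' _ w'P|/(_ w)]; last by case.
apply/rowP => i; have [si vi] := coord_function_smooth i cx.
by rewrite -wE -!vi w'P// H.
Qed.

Lemma smooth_vfield_differentiable c x Y : smooth_vfield_at Y x -> dom c x ->
  differentiable (vfield_coord c x Y) (coord c x).
Proof.
move=> sY cx.
have [_ /differentiableP D] := diff_at_charts HA
  (atlas_compatible (tangent_bundle_atlas HM)) (smooth_at_diff_at sY) (e := c) cx cx.
exact: is_diff_differentiable (is_diff_comp_at D erefl (is_diff_snd _)).
Qed.

(** An extension of a given vector. It keeps the conditions in [nabla_at] and [torsion], which range
    over all extensions, from being vacuous, and it provides the test fields for affine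
    extensions. *)
Definition constant_vfield c v : @vfield R n M A := fun x => tvec c x v.

Lemma constant_vfieldK c x (v : tangent A x) : dom c x -> constant_vfield c (v c) x = v.
Proof. exact: tvecK. Qed.

Lemma constant_vfield_near c x v : dom c x ->
  \forall u \near coord c x, v = vfield_coord c x (constant_vfield c v) u.
Proof.
move=> cx; apply: filterS (near_inv_coord HA x cx) => u [cu _].
by rewrite /vfield_coord tvecE.
Qed.

Lemma constant_vfield_smooth c x v : dom c x -> smooth_vfield_at (constant_vfield c v) x.
Proof.
move=> cx; exists c, c; split => //.
  by apply: filterS (near_inv_coord HA x cx) => u [].
apply: (@smooth_near_eq R _ _ (fun u : 'rV[R]_n => (u, v))).
  apply: filterS2 (near_inv_coord HA x cx) (constant_vfield_near v cx) => u [_ uE] vE.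
  by rewrite /local_expr /= uE {1}vE.
exists setT => [|k]; first by split => //; exact: openT.
have D (u : 'rV[R]_n) := is_diff_pair (is_diff_id u) (is_diff_cst v u).
exact: (Ck_affine k openT D).
Qed.

Lemma jet_repP x (eta : jet11 A x) :
  bis_dom (jet_rep eta) x /\ jet_class eta = j1 x (jet_rep eta).
Proof. by rewrite /jet_rep; case: cid. Qed.

(* If [eta] is represented by [b], this is [Q], the differential of the matrix of
   [b]; together with the matrix [B] of [jet_p eta] it determines a semiholonomic
   jet. *)
Definition jet_dmx x (eta : jet11 A x) c d : 'rV[R]_n -> 'M[R]_n :=
  'd (bis_mx x c d (jet_rep eta)) (coord c x).

Lemma semiholonomicP x y (xi : tiso A x y) (eta : jet11 A x) c d :
  jet_p eta = existT (tiso A x) y xi -> dom c x -> dom d y ->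
  semiholonomic eta <->
  forall h, 'd (bis_phi x c d (jet_rep eta)) (coord c x) h = h *m iso_mx xi c d.
Proof.
move=> pE cx dy; have [bx _] := jet_repP eta.
have T v w := tdiff_bis0 HM bx pE cx dy v w.
have E v : existT (tangent A) _ (tagged (jet_p eta) v) = existT (tangent A) y (xi v).
  by rewrite pE.
split=> [H h|H v].
  have [v <-] := tangent_ex HA h cx.
  rewrite -(iso_mxE HM _ _ _ cx); apply/esym/T.
  by rewrite -E H.
have : existT (tangent A) _ (tagged (jet_p eta) v) = existT (tangent A) _ (jet_pstar eta v).
  by rewrite E; apply/T; rewrite H (iso_mxE HM _ _ _ cx).
move=> K; apply: (@tangent_at_inj _ _ _ _ _ _ _ d).
  by rewrite [tag _]/(tag (jet_p eta)) pE.
exact: (congr1 (fun z : {x & tangent A x} => tagged z d) K).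
Qed.

Section Nabla.
Variable s : forall x, jet11 A x.
Hypothesis Hs : symmetry_jet s.

(* The differential [Q_x] for the jet [s x]. The Christoffel form of the
   connection is [- 2^-1 *: (Y *m Q_x X)]: the factor [- 2^-1] is left out. *)
Definition christoffel c x : 'rV[R]_n -> 'M[R]_n := jet_dmx (s x) c c.

Lemma christoffel_linear c x : linear (christoffel c x).
Proof. by move=> a u v; rewrite /christoffel /jet_dmx linearP. Qed.

Lemma mul_neg_id_mx c x (v : 'rV[R]_n) : dom c x -> v *m iso_mx (neg_id A x) c c = - v.
Proof.
move=> cx; have [w <-] := tangent_ex HA v cx.
by rewrite -(iso_mxE HM).
Qed.

(** The field [Z = Y + s_x Y] vanishes at [x], so only its derivative along [X x] survives in the
    bracket. [push_is_diff] gives the contribution of [s_x Y], evaluated in the direction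
    [- X x]. *)
Lemma nablaE c x X Y : dom c x ->
  differentiable (vfield_coord c x X) (coord c x) ->
  differentiable (vfield_coord c x Y) (coord c x) ->
  nabla s X Y x c = 'd (vfield_coord c x Y) (coord c x) (X x c) -
    2^-1 *: (Y x c *m christoffel c x (X x c)).
Proof.
move=> cx dX dY; have [sh /(_ x) sp _] := Hs.
have [bx _] := jet_repP (s x).
have [dP PE] := push_is_diff HM bx sp cx cx dY.
have dphi h := (semiholonomicP sp cx cx).1 (sh x) h.
pose Z : @vfield R n M A := fun x' => Y x' + push (jet_rep (s x)) Y x'.
have DZ : is_diff (coord c x) (vfield_coord c x Z)
  (fun h => 'd (vfield_coord c x Y) (coord c x) h +
            'd (vfield_coord c x (push (jet_rep (s x)) Y)) (coord c x) h).
  by apply: (is_diff_fun (is_diffD (differentiableP dY) (differentiableP dP))) => h; reflexivity.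
have Zx : Z x c = 0.
  by rewrite /Z tangentD (push_at bx sp cx); exact: subrr.
(* The base map of [s x] has differential [- id] at [x]. *)
have dphiN : 'd (bis_phi x c c (jet_rep (s x))) (coord c x) (- X x c) = X x c.
  by rewrite dphi mul_neg_id_mx// opprK.
have PX : 'd (vfield_coord c x (push (jet_rep (s x)) Y)) (coord c x) (X x c) =
    'd (vfield_coord c x Y) (coord c x) (X x c) - Y x c *m christoffel c x (X x c).
  rewrite -{1}dphiN; apply: etrans (PE _) _; congr (_ + _).
    apply: etrans (mul_neg_id_mx _ cx) _.
    apply: etrans (congr1 -%R (linearN ('d (vfield_coord c x Y) (coord c x)) _)) _.
    exact: opprK.
  rewrite -mulmxN; congr (_ *m _); exact: linearN.
rewrite /nabla tangentZ -/Z (bracketE cx dX (is_diff_differentiable DZ)) Zx.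
have D0 : 'd (vfield_coord c x X) (coord c x) 0 = 0 by exact: linear0.
have alg (p q : 'rV[R]_n) : 2^-1 *: (p + (p - q) - 0) = p - 2^-1 *: q.
  by apply/rowP => i; rewrite !mxE; lra.
have DZX := etrans (is_diffE DZ (X x c)) (congr1 (GRing.add _) PX).
exact: (etrans (congr1 ( *:%R 2^-1) (congr2 (fun a b => a - b) DZX D0)) (alg _ _)).
Qed.

Lemma nabla_atE c x (v : tangent A x) Y : dom c x ->
  differentiable (vfield_coord c x Y) (coord c x) ->
  nabla_at s v Y c = 'd (vfield_coord c x Y) (coord c x) (v c) -
    2^-1 *: (Y x c *m christoffel c x (v c)).
Proof.
move=> cx dY; set rhs := _ - _; have [w wE] := tangent_ex HA rhs cx.
rewrite /nabla_at; case: xgetP => [w' _ w'P|/(_ w) []] /=.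
  have cs := constant_vfield_smooth (v c) cx.
  rewrite (w'P _ cs (constant_vfieldK v cx)).
  by rewrite (nablaE cx (smooth_vfield_differentiable cs cx) dY) constant_vfieldK.
move=> X sX Xv; apply: (tangent_at_inj cx); rewrite wE.
by rewrite (nablaE cx (smooth_vfield_differentiable sX cx) dY) Xv.
Qed.

(** The derivatives of the two fields cancel against the bracket, so the value depends on [v] and
    [w] alone and the selection in [torsion] succeeds. *)
Lemma torsionE c x (v w : tangent A x) : dom c x ->
  torsion s v w c =
    2^-1 *: (v c *m christoffel c x (w c) - w c *m christoffel c x (v c)).
Proof.
move=> cx; set rhs := _ *: _.
have H X Y : smooth_vfield_at X x -> smooth_vfield_at Y x -> X x = v -> Y x = w ->
    (nabla s X Y x - nabla s Y X x - bracket X Y x) c = rhs.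
  move=> sX sY Xv Yw.
  have dX := smooth_vfield_differentiable sX cx.
  have dY := smooth_vfield_differentiable sY cx.
  have alg (p q a b : 'rV[R]_n) : p - a - (q - b) - (p - q) = b - a.
    by apply/rowP => i; rewrite !mxE; ring.
  have N1 := nablaE cx dX dY; have N2 := nablaE cx dY dX; have N3 := bracketE cx dX dY.
  rewrite Xv Yw in N1 N2 N3; rewrite /rhs scalerBr.
  have N := congr2 (fun a b => a - b) (congr2 (fun a b => a - b) N1 N2) N3.
  exact: (etrans N (alg _ _ _ _)).
have [t tE] := tangent_ex HA rhs cx.
rewrite /torsion; case: xgetP => [t' _ t'P|/(_ t) []] /=.
  have csv := constant_vfield_smooth (v c) cx.
  have csw := constant_vfield_smooth (w c) cx.
  have Ev := constant_vfieldK v cx; have Ew := constant_vfieldK w cx.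
  by rewrite (t'P _ _ csv csw Ev Ew) H.
by move=> X Y sX sY Xv Yw; apply: (tangent_at_inj cx); rewrite tE H.
Qed.

(** Both sides of the affine condition contain the derivative of [Y] multiplied by the matrix of
    [xi]. After cancellation only the value of [Y] at [x] is left, so fields constant in the chart
    test the whole condition. *)
Lemma affine_extensionP x y (xi : tiso A x y) (eta : jet11 A x) c d :
  dom c x -> dom d y ->
  affine_extension s xi eta <->
  [/\ jet_p eta = existT (tiso A x) y xi,
     forall h, 'd (bis_phi x c d (jet_rep eta)) (coord c x) h = h *m iso_mx xi c d &
     forall v w : 'rV[R]_n, w *m jet_dmx eta c d v =
       2^-1 *: (w *m iso_mx xi c d *m christoffel d y (v *m iso_mx xi c d) -
                w *m christoffel c x v *m iso_mx xi c d)].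
Proof.
move=> cx dy; set B := iso_mx xi c d.
suff main : jet_p eta = existT (tiso A x) y xi ->
    (forall h, 'd (bis_phi x c d (jet_rep eta)) (coord c x) h = h *m B) ->
    (forall (v : tangent A x) Y, smooth_vfield_at Y x ->
      (xi (nabla_at s v Y) = nabla_at s (xi v) (push (jet_rep eta) Y) <->
      Y x c *m jet_dmx eta c d (v c) =
       2^-1 *: (Y x c *m B *m christoffel d y (v c *m B) -
                Y x c *m christoffel c x (v c) *m B))).
  split=> [[sh pE aff]|[pE sh aff]].
    have sh' := (semiholonomicP pE cx dy).1 sh; split=> // v w.
    have sY := constant_vfield_smooth w cx.
    have := (main pE sh' (tvec c x v) _ sY).1 (aff _ _ sY).
    by rewrite /constant_vfield !tvecE.
  split=> //; first exact: (semiholonomicP pE cx dy).2.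
  by move=> v Y sY; apply: (main pE sh v Y sY).2; exact: aff.
move=> pE sh v Y sY; have [bx _] := jet_repP eta.
have dY := smooth_vfield_differentiable sY cx.
have [dP PE] := push_is_diff HM bx pE cx dy dY.
have pyE := push_at bx pE dy Y.
have E1 : xi (nabla_at s v Y) d =
    ('d (vfield_coord c x Y) (coord c x) (v c) - 2^-1 *: (Y x c *m christoffel c x (v c))) *m B.
  by rewrite (iso_mxE HM _ _ _ cx) (nabla_atE _ cx dY).
have E2 : nabla_at s (xi v) (push (jet_rep eta) Y) d =
    'd (vfield_coord c x Y) (coord c x) (v c) *m B + Y x c *m jet_dmx eta c d (v c) -
    2^-1 *: (Y x c *m B *m christoffel d y (v c *m B)).
  rewrite (nabla_atE _ dy dP) pyE !(iso_mxE HM _ _ _ cx) -/B; congr (_ - _).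
  by rewrite -sh; exact: PE.
have alg (p q r t : 'rV[R]_n) : (p - r = p + q - t) <-> q = t - r.
  split=> [E|->]; last by rewrite (addrC t) addrA addrK.
  by apply: (@addrI _ p); rewrite addrCA E addrC subrK.
have key := alg ('d (vfield_coord c x Y) (coord c x) (v c) *m B)
  (Y x c *m jet_dmx eta c d (v c))
  (2^-1 *: (Y x c *m christoffel c x (v c) *m B))
  (2^-1 *: (Y x c *m B *m christoffel d y (v c *m B))).
rewrite scalerBr; split=> [E|/key.2 E].
  by apply/key.1; rewrite -E2 -E E1 mulmxBl scalemxAl.
by apply: (tangent_at_inj dy); rewrite E1 E2 mulmxBl -scalemxAl.
Qed.

End Nabla.

End Connections.

(** * The action of (1,1)-jets on the second tangent bundle *)

Section JetAction.
Context {R : realType} {n : nat} {M : topologicalType} {A : charted 'rV[R]_n M}.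
Hypothesis HM : smooth_manifold A.
Implicit Types (c d : chart A) (x y : M).
Local Notation TM := {x : M & tangent A x}.
Local Notation TA := (tangent_bundle A).
Local Notation T2M := {z : TM & tangent TA z}.
Let HA := manifold_atlas HM.
Let HTA := tangent_bundle_atlas HM.

Lemma velocity_exists (Z : T2M) : exists g : R^o -> TM,
  smooth_at (self_charted R^o) TA g 0 /\ velocity TA g = Z.
Proof.
have [c cx] := chart_at HM (t2_base Z).
set x := t2_base Z in cx; set X := tagged (tag Z) c.
set a := (tagged Z c).1; set V := (tagged Z c).2.
(* A straight line in the induced chart of TM, through the base point of [Z] and with its components
   as velocity. *)
pose g (t : R^o) : TM := existT (tangent A) (inv_coord c x (coord c x + t *: a))
  (tvec c _ (X + t *: V)).
have L0 := is_diff_line (coord c x) a (0 : R^o).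
have C0 : (fun t : R^o => coord c x + t *: a) t @[t --> (0 : R^o)] --> coord c x.
  have := differentiable_continuous (is_diff_differentiable L0).
  by rewrite /prop_for /continuous_at scale0r addr0.
have N : \forall t \near (0 : R^o), dom c (tag (g t)) /\
    (coord c x + t *: a, X + t *: V) = coord (c := TA) c (g t).
  have N0 : \forall t \near (0 : R^o), dom c (inv_coord c x (coord c x + t *: a)) /\
      coord c (inv_coord c x (coord c x + t *: a)) = coord c x + t *: a.
    exact: C0 _ (near_inv_coord HA x cx).
  apply: filterS N0 => t [ct tE]; split => //=.
  by rewrite tvecE// tE.
have D t : is_diff (t : R^o) (fun t : R^o => (coord c x + t *: a, X + t *: V))
    (fun h : R^o => (h *: a, h *: V)).
  exact: is_diff_pair (is_diff_line _ _ _) (is_diff_line _ _ _).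
have [c0 g0E] := nbhs_singleton N.
have {}g0E : g 0 = tag Z.
  apply: (@tangent_bundle_inj _ _ _ _ HM c) => //; move: g0E; rewrite !scale0r !addr0.
    by move=> [<- _].
  by move=> [_ <-].
exists g; split.
  exists tt, c; split => //.
    by apply: filterS N => t [ct _]; rewrite self_inv_coord.
  apply: (@smooth_near_eq R _ _ (fun t : R^o => (coord c x + t *: a, X + t *: V))).
    by apply: filterS N => t [_ tE]; rewrite /local_expr self_inv_coord.
  exists setT => [|k]; first by split => //; exact: openT.
  exact: Ck_affine openT D.
apply: (@t2coord_inj _ _ _ _ HM c) => //.
have N1 : \forall t \near (0 : R^o), dom (c := TA) c (g t) by apply: filterS N => t [].
have N2 : \forall t \near (0 : R^o), (coord c x + t *: a, X + t *: V) = coord (c := TA) c (g t).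
  by apply: filterS N => t [].
have W := velocityE HTA c0 N1 (near_eq_is_diff N2 (D 0)).
rewrite !t2coordE W !scale1r /t2_base.
have -> : tag (velocity TA g) = tag Z by exact: g0E.
by rewrite -surjective_pairing.
Qed.

(** By the product rule for X_t B(x_t), every curve with velocity [Z] leads to these coordinates, so
    the selected curve does not matter. The base component keeps the differential of [bis_phi];
    semiholonomy identifies it with a product later. *)
Lemma jet_actE x y (xi : tiso A x y) (eta : jet11 A x) c d (Z : T2M) X a V :
  jet_p eta = existT (tiso A x) y xi -> dom c x -> dom d y -> t2_base Z = x ->
  t2coord c Z = ((coord c x, X), (a, V)) ->
  t2_base (jet_act eta Z) = y /\
  t2coord d (jet_act eta Z) = ((coord d y, X *m iso_mx xi c d),
    ('d (bis_phi x c d (jet_rep eta)) (coord c x) a,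
     V *m iso_mx xi c d + X *m jet_dmx eta c d a)).
Proof.
move=> pE cx dy bZ ZE; have [bx _] := jet_repP eta.
set b := jet_rep eta in bx *.
have bxi : b x = existT (tiso A x) y xi by exact: pE.
rewrite /jet_act; case: xgetP => [Z' _ [g [sg gZ ->]]|]; last first.
  have [g [sg gZ]] := velocity_exists Z.
  by move=> /(_ (velocity TA (fun t => bis_mul b (g t)))) []; exists g.
have g0 : g 0 = tag Z by exact: (congr1 (fun Z : T2M => tag Z) gZ).
have g0x : tag (g 0) = x by rewrite g0.
have cg0 : dom c (tag (g 0)) by rewrite g0x.
have [N0 /differentiableP D0] := diff_at_charts (self_atlas R^o) (atlas_compatible HTA)
  (c := tt) (e := c) (smooth_at_diff_at sg) I cg0.
have N : \forall t \near (0 : R^o), dom c (tag (g t)).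
  by apply: filterS N0 => t; rewrite self_inv_coord.
have [Dg D] : exists Dg, is_diff (0 : R^o) (fun t => coord (c := TA) c (g t)) Dg.
  eexists; refine (near_eq_is_diff _ D0).
  by near=> t; rewrite /local_expr self_inv_coord.
have vE := velocityE HTA cg0 N D.
have Dg1 : Dg 1 = (a, V).
  rewrite -vE gZ; exact: (congr1 (fun p => p.2) ZE).
have u0E : coord (c := TA) c (g 0) = (coord c x, X).
  rewrite g0; exact: (congr1 (fun p => p.1) ZE).
have [/differentiableP Dphi /differentiableP Dmx] := bis_local_differentiable HM bx bxi cx dy.
have mxE := bis_mx_at HM d bxi cx.
have D1 := is_diff_comp_at D u0E (is_diff_fst _).
have D2 := is_diff_comp_at D u0E (is_diff_snd _).
have E1 : (coord (c := TA) c (g 0)).1 = coord c x by rewrite u0E.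
have Dp := is_diff_comp_at D1 E1 Dphi.
have Dm := is_diff_mulmx D2 (is_diff_comp_at D1 E1 Dmx).
have C1 : (coord (c := TA) c (g t)).1 @[t --> (0 : R^o)] --> coord c x.
  rewrite -E1; exact: differentiable_continuous (is_diff_differentiable D1).
have N' : \forall t \near (0 : R^o), dom d (tag (bis_mul b (g t))).
  have N1 : \forall t \near (0 : R^o),
      [/\ bis_dom b (inv_coord c x (coord (c := TA) c (g t)).1),
          dom c (inv_coord c x (coord (c := TA) c (g t)).1) &
          dom d (bis0 b (inv_coord c x (coord (c := TA) c (g t)).1))].
    exact: C1 _ (bis_near HM bx bxi cx dy).
  by apply: filterS2 N N1 => t ct [_ _]; rewrite /= (coordK HA).
have hE : \forall t \near (0 : R^o),
    (bis_phi x c d b (coord (c := TA) c (g t)).1,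
     (coord (c := TA) c (g t)).2 *m bis_mx x c d b (coord (c := TA) c (g t)).1) =
    coord (c := TA) d (bis_mul b (g t)).
  apply: filterS N => t ct; rewrite /bis_phi /bis_mx /= (coordK HA)//.
  congr pair; exact/esym/(iso_mxE HM).
have dh0 := nbhs_singleton N'.
have K := velocityE HTA dh0 N' (near_eq_is_diff hE (is_diff_pair Dp Dm)).
have base : tag (bis_mul b (g 0)) = y by rewrite /= g0x (bis0E bxi).
split; first exact: base.
rewrite t2coordE K Dg1 E1 mxE.
have X0 : (coord (c := TA) c (g 0)).2 = X by rewrite u0E.
rewrite X0 /t2_base.
have -> : tag (velocity TA (fun t => bis_mul b (g t))) = bis_mul b (g 0) by [].
have XE : tagged (bis_mul b (g 0)) d = X *m iso_mx xi c d.
  have := nbhs_singleton hE; rewrite E1 mxE u0E => /(congr1 (fun p => p.2)) /= h2.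
  exact: esym h2.
exact: (congr2 pair (congr2 pair (congr1 (coord d) base) XE) erefl).
Unshelve. all: by end_near. Qed.

End JetAction.

(** * Constructing bisections and jets *)

Section Construction.
Context {R : realType} {n : nat} {M : topologicalType} {A : charted 'rV[R]_n M}.
Hypothesis HM : smooth_manifold A.
Implicit Types (c d : chart A) (x y : M).
Let HA := manifold_atlas HM.

Lemma open_setI_preimage (T1 T2 : topologicalType) (P : set T1) (Q : set T2) (h : T1 -> T2) :
  open P -> (forall p, P p -> {for p, continuous h}) -> open Q ->
  open (P `&` h @^-1` Q).
Proof.
move=> oP ch oQ; rewrite openE => p [Pp Qp]; apply: filterI.
  by apply: open_nbhs_nbhs.
by apply: (ch p Pp); exact: open_nbhs_nbhs.
Qed.

Lemma existT_inj (T : Type) (F : T -> Type) (t : T) (a b : F t) :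
  existT F t a = existT F t b -> a = b.
Proof.
move=> E; have := projT2_eq E.
by rewrite (Prop_irrelevance (projT1_eq E) erefl).
Qed.

Lemma tiso_ex x y c d (B : 'M[R]_n) : dom c x -> dom d y -> B \in unitmx ->
  exists xi : tiso A x y, iso_mx xi c d = B.
Proof.
move=> cx dy uB.
pose f (v : tangent A x) : tangent A y := tvec d y (v c *m B).
have fl : linear f.
  by move=> a v w; rewrite /f tangentD tangentZ mulmxDl -scalemxAl tvec_linear.
pose L : {linear tangent A x -> tangent A y} :=
  HB.pack f (GRing.isLinear.Build R _ _ _ _ fl).
have fb : bijective (L : tangent A x -> tangent A y).
  exists (fun w : tangent A y => tvec c x (w d *m invmx B)) => v.
    by rewrite /= /f tvecE// mulmxK// tvecK.
  by rewrite /= /f tvecE// mulmxKV// tvecK.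
exists (@TIso _ _ _ A x y L fb); apply/row_matrixP => i; rewrite !rowE.
apply: etrans (mul_rV_lin1_fun _ _) _.
  by move=> a u w; rewrite tvec_linear// linearP tangentD tangentZ.
by rewrite /= /f !tvecE.
Qed.

(** Reduces the construction of a bisection to chart data. The inverse [psi] of the base map is part
    of the data, and the domain is cut down until all points stay inside the two charts. *)
Lemma bisection_ex x y (xi : tiso A x y) c d (phi psi : 'rV[R]_n -> 'rV[R]_n)
    (B : 'rV[R]_n -> 'M[R]_n) (P P' : set 'rV[R]_n) :
  dom c x -> dom d y -> open P -> open P' -> P (coord c x) -> P' (coord d y) ->
  phi (coord c x) = coord d y -> B (coord c x) = iso_mx xi c d ->
  (forall k, Ck k P phi) -> (forall k, Ck k P' psi) -> (forall k, Ck k P B) ->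
  (forall u, P u -> psi (phi u) = u) -> (forall v, P' v -> phi (psi v) = v) ->
  (forall u, P u -> B u \in unitmx) ->
  exists b : bisection A, [/\ bis_dom b x, b x = existT (tiso A x) y xi &
    forall x1, bis_dom b x1 -> [/\ dom c x1, P (coord c x1), dom d (bis0 b x1),
      coord d (bis0 b x1) = phi (coord c x1) &
      iso_mx (tagged (b x1)) c d = B (coord c x1)]].
Proof.
move=> cx dy oP oP' Px P'y phix Bx Cphi Cpsi CB phiK psiK uB.
(* On [W] the value of [phi] is the coordinate of an actual point of the chart [d] and lies where
   [psi] inverts [phi]. *)
pose W := P `&` phi @^-1` (P' `&` coord d @` dom d).
have oimc : open (coord c @` dom c) by apply: open_coord_image => //; exact: open_dom.
have oimd : open (coord d @` dom d) by apply: open_coord_image => //; exact: open_dom.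
have oW : open W.
  apply: open_setI_preimage => //; last exact: openI.
  by move=> p Pp; exact: Ck_continuous (Cphi 0%N) Pp.
(* [O] is the image in the chart [c] of the domain [U]; [O'] below is the image in the chart [d] of
   [U] under [f]. *)
pose O := W `&` coord c @` dom c.
have oO : open O by exact: openI.
pose W' := P' `&` psi @^-1` O.
have oW' : open W'.
  apply: open_setI_preimage => //.
  by move=> p Pp; exact: Ck_continuous (Cpsi 0%N) Pp.
pose O' := W' `&` coord d @` dom d.
have oO' : open O' by exact: openI.
pose U := dom c `&` coord c @^-1` W.
have oU : open U.
  apply: open_setI_preimage => //; first exact: open_dom.
  by move=> p cp; exact: continuous_coord.
have UO x1 : U x1 -> O (coord c x1) by move=> [cx1 Wx1]; split => //; exists x1.
pose f x1 := inv_coord d y (phi (coord c x1)).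
pose g y1 := inv_coord c x (psi (coord d y1)).
have fP x1 : U x1 -> dom d (f x1) /\ coord d (f x1) = phi (coord c x1).
  move=> [cx1 [Px1 [P'x1 [y1 dy1 y1E]]]].
  by rewrite /f -y1E (coordK HA).
have gf x1 : U x1 -> g (f x1) = x1.
  move=> Ux1; have [_ fE] := fP _ Ux1; have [cx1 [Px1 _]] := Ux1.
  by rewrite /g fE phiK// (coordK HA).
have OU u : O u ->
    [/\ dom c (inv_coord c x u), coord c (inv_coord c x u) = u & U (inv_coord c x u)].
  move=> [Wu [x1 cx1 x1E]]; rewrite -x1E in Wu *.
  by rewrite (coordK HA).
have O'f v : O' v -> [/\ dom d (inv_coord d y v), coord d (inv_coord d y v) = v &
    dom c (g (inv_coord d y v)) /\ coord c (g (inv_coord d y v)) = psi v].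
  move=> [[P'v Ov] [y1 dy1 y1E]]; rewrite -y1E in P'v Ov *.
  rewrite (coordK HA)//; split => //; rewrite /g.
  by have [? ? _] := OU _ Ov.
have fO' x1 : U x1 -> O' (coord d (f x1)).
  move=> Ux1; have [df fE] := fP _ Ux1; have [cx1 [Px1 [P'x1 im1]]] := Ux1.
  rewrite fE; split => //; split => //.
  by rewrite /preimage/= phiK//; exact: UO.
(* This description by preimages is what shows the image to be open. *)
have fU : f @` U = dom d `&` coord d @^-1` W'.
  apply/seteqP; split=> [_ [x1 Ux1 <-]|y1 [dy1 [P'y1 Oy1]]].
    by split; [exact: (fP _ Ux1).1|exact: (fO' _ Ux1).1].
  have [c1 E1 U1] := OU _ Oy1; exists (inv_coord c x (psi (coord d y1))) => //.
  by rewrite /f E1 psiK// (coordK HA).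
(* The value at [x] has to be [xi] itself, over [y] itself, whereas elsewhere in [U] any isomorphism
   with the right matrix will do. The transport along [x = x1] expresses this in the dependent type;
   outside [U] the value is arbitrary. *)
have Hval x1 : exists z : iso_from A x1,
    (U x1 -> tag z = f x1 /\ iso_mx (tagged z) c d = B (coord c x1)) /\
    forall e : x = x1, z = eq_rect x (iso_from A) (existT (tiso A x) y xi) x1 e.
  have [e|nxx1] := pselect (x = x1).
    subst x1; exists (existT (tiso A x) y xi); split=> [Ux|e].
      by rewrite /f phix (coordK HA).
    by rewrite (Prop_irrelevance e erefl).
  have [Ux1|nU] := pselect (U x1); last first.
    by exists (existT (tiso A x1) x1 (neg_id A x1)).
  have [df _] := fP _ Ux1; have [cx1 [Px1 _]] := Ux1.
  have [xi1 xi1E] := tiso_ex cx1 df (uB _ Px1).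
  by exists (existT (tiso A x1) (f x1) xi1).
pose val x1 := sval (cid (Hval x1)).
have valP x1 : U x1 -> tag (val x1) = f x1 /\ iso_mx (tagged (val x1)) c d = B (coord c x1).
  exact: (svalP (cid (Hval x1))).1.
have valx : val x = existT (tiso A x) y xi.
  exact: (svalP (cid (Hval x))).2 erefl.
have Ux : U x.
  by split => //; split=> //; rewrite /preimage/= phix; split=> //; exists y.
have bs x1 : U x1 -> smooth_at A (B1_charted A) (fun x' => existT (iso_from A) x' (val x')) x1.
  move=> Ux1; have [tE _] := valP _ Ux1; have [df _] := fP _ Ux1.
  have nO : nbhs (coord c x1) O by apply: open_nbhs_nbhs; split => //; exact: UO.
  have key u : O u -> (inv_coord c x1 u = inv_coord c x u) /\
      (u, (phi u, B u)) = local_expr (A := A) (B := B1_charted A)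
        (fun x' => existT (iso_from A) x' (val x')) x1 c (c, d) u.
    move=> Ou; have [cu uE Uu] := OU _ Ou.
    have iE : inv_coord c x1 u = inv_coord c x u by rewrite -{1}uE (coordK HA).
    split => //; rewrite /local_expr iE /=.
    have [tE2 ->] := valP _ Uu; have [_ fE2] := fP _ Uu.
    by rewrite tE2 fE2 uE.
  exists c, (c, d); split.
  - by case: Ux1.
  - by split; [case: Ux1|rewrite /= tE].
  - apply: filterS nO => u Ou; have [-> _] := key _ Ou.
    have [cu uE Uu] := OU _ Ou; have [t2E _] := valP _ Uu.
    by split => //=; rewrite t2E; exact: (fP _ Uu).1.
  - apply: (@smooth_near_eq R _ _ (fun u => (u, (phi u, B u)))).
      by apply: filterS nO => u Ou; exact: (key _ Ou).2.
    exists O => [|k]; first by split => //; exact: UO.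
    have OP : O `<=` P by move=> u [[]].
    apply: Ck_pair => //; first exact: (Ck_affine k oO (fun u => is_diff_id u)).
    by apply: Ck_pair => //; exact: Ck_subset OP _.
have tU : (fun x1 => tag (val x1)) @` U = f @` U.
  by apply/seteqP; split=> [_ [x1 Ux1 <-]|_ [x1 Ux1 <-]]; exists x1 => //;
    rewrite (valP _ Ux1).1.
have bd : local_diffeo A U (fun x1 => tag (val x1)).
  split => //.
  - move=> x1 Ux1; have [cx1 W1] := Ux1.
    have nO : nbhs (coord c x1) O by apply: open_nbhs_nbhs; split => //; exact: UO.
    have key u : O u -> dom d (tag (val (inv_coord c x1 u))) /\
        phi u = local_expr (A := A) (B := A) (fun x' => tag (val x')) x1 c d u.
      move=> Ou; have [cu uE Uu] := OU _ Ou.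
      have iE : inv_coord c x1 u = inv_coord c x u by rewrite -{1}uE (coordK HA).
      rewrite /local_expr iE (valP _ Uu).1; have [? ->] := fP _ Uu.
      by rewrite uE.
    exists c, d; split => //.
    + by rewrite (valP _ Ux1).1; exact: (fP _ Ux1).1.
    + by apply: filterS nO => u /key[].
    + apply: (@smooth_near_eq R _ _ phi); first by apply: filterS nO => u /key[].
      exists P => //; split => //; by case: W1.
  - rewrite tU fU; apply: open_setI_preimage => //; first exact: open_dom.
    by move=> p dp; exact: continuous_coord.
  - exists g => x1 Ux1; rewrite (valP _ Ux1).1 gf//; split => //.
    have [df fE] := fP _ Ux1.
    have nO : nbhs (coord d (f x1)) O' by apply: open_nbhs_nbhs; split => //; exact: fO'.
    have key v : O' v -> dom c (g (inv_coord d (f x1) v)) /\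
        psi v = local_expr (A := A) (B := A) g (f x1) d c v.
      move=> Ov; have [dv vE [cg gE]] := O'f _ Ov.
      have iE : inv_coord d (f x1) v = inv_coord d y v by rewrite -{1}vE (coordK HA).
      by rewrite /local_expr iE gE.
    exists d, c; split => //.
    + by rewrite gf//; case: Ux1.
    + by apply: filterS nO => u /key[].
    + apply: (@smooth_near_eq R _ _ psi); first by apply: filterS nO => u /key[].
      by exists P' => //; split => //; case: (fO' _ Ux1) => -[].
exists (Bisection bs bd); split => // x1 Ux1.
have [cx1 [Px1 _]] := Ux1; have [tE mE] := valP _ Ux1; have [df fE] := fP _ Ux1.
by split=> //; rewrite /bis0 /= tE.
Qed.

End Construction.

(** * Jets with prescribed components; existence of the affine extension and of [kappa] *)

Section JetExistence.
Context {R : realType} {n : nat} {M : topologicalType} {A : charted 'rV[R]_n M}.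
Hypothesis HM : smooth_manifold A.
Implicit Types (c d : chart A) (x y : M).
Let HA := manifold_atlas HM.

Lemma bis_coords_near (b : bisection A) c d (phi : 'rV[R]_n -> 'rV[R]_n)
    (B : 'rV[R]_n -> 'M[R]_n) x :
  (forall x1, bis_dom b x1 -> coord d (bis0 b x1) = phi (coord c x1) /\
     iso_mx (tagged (b x1)) c d = B (coord c x1)) ->
  bis_dom b x -> dom c x ->
  \forall u \near coord c x, phi u = bis_phi x c d b u /\ B u = bis_mx x c d b u.
Proof.
move=> H bx cx; have [ob _ _ _] := bis_diffeo b.
apply: filterS2 (near_inv_coord_open HM x ob bx cx) (near_inv_coord HA x cx) => u bu [_ uE].
by have [E1 E2] := H _ bu; rewrite /bis_phi /bis_mx E1 E2 uE.
Qed.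

(** [jet_rep] is an arbitrary choice in the class; the components of a jet may be computed from any
    representative. *)
Lemma jet_rep_bisection (b : bisection A) x y (xi : tiso A x y) (eta : jet11 A x) c d :
  jet_class eta = j1 x b -> bis_dom b x -> b x = existT (tiso A x) y xi ->
  dom c x -> dom d y ->
  [/\ jet_p eta = existT (tiso A x) y xi,
    'd (bis_phi x c d (jet_rep eta)) (coord c x) =1 'd (bis_phi x c d b) (coord c x) &
    jet_dmx eta c d =1 'd (bis_mx x c d b) (coord c x)].
Proof.
move=> etaE bx bxi cx dy; have [rx rE] := jet_repP eta.
have : j1 x (jet_rep eta) (jet_rep eta) by split.
rewrite -rE etaE => -[_ same].
have pE : jet_p eta = existT (tiso A x) y xi.
  rewrite -bxi; apply/esym/existT_inj; exact: same.1.
have [H1 H2] := (same_jet1_bisP HM bx rx bxi pE cx dy).1 same.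
split; [exact: pE|move=> h; exact: esym (H1 h)|move=> h; exact: esym (H2 h)].
Qed.

Lemma jet_of_bisection (b : bisection A) x : bis_dom b x ->
  exists eta : jet11 A x, jet_class eta = j1 x b.
Proof.
move=> bx; have H : exists b', bis_dom b' x /\ j1 x b = j1 x b' by exists b.
by exists (Jet11 H).
Qed.

Lemma jet_class_eq (b : bisection A) x y (xi : tiso A x y) (eta : jet11 A x) c d :
  bis_dom b x -> b x = existT (tiso A x) y xi -> jet_p eta = existT (tiso A x) y xi ->
  dom c x -> dom d y ->
  'd (bis_phi x c d b) (coord c x) =1 'd (bis_phi x c d (jet_rep eta)) (coord c x) ->
  'd (bis_mx x c d b) (coord c x) =1 jet_dmx eta c d ->
  jet_class eta = j1 x b.
Proof.
move=> bx bxi pE cx dy H1 H2; have [rx rE] := jet_repP eta.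
have [E1 same] := (same_jet1_bisP HM bx rx bxi pE cx dy).2 (conj H1 H2).
rewrite rE; apply/seteqP; split=> b' [b'x [E2 same2]]; (split; first exact: b'x).
  split=> [|c' d' c'x d'x h]; first exact: (etrans E1 E2).
  have d'x' : dom d' (bis_pt (jet_rep eta) x) by rewrite -E1.
  exact: (etrans (same c' d' c'x d'x h) (same2 c' d' c'x d'x' h)).
split=> [|c' d' c'x d'x h]; first exact: (etrans (esym E1) E2).
have d'x' : dom d' (bis_pt b x) by rewrite E1.
exact: (etrans (esym (same c' d' c'x d'x' h)) (same2 c' d' c'x d'x' h)).
Qed.

Lemma is_diff_affine (W : normedModType R) p q (L : {linear 'M[R]_(p, q) -> W}) (a : W) u0 u :
  is_diff u (fun u => a + L (u - u0)) L.
Proof.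
have D := is_diff_comp_at (is_diffB (is_diff_id u) (is_diff_cst u0 u)) erefl (linear_mx_is_diff L _).
apply: (is_diff_fun (is_diffD (is_diff_cst a u) D)) => // h.
by rewrite -[LHS]/(0 + L (h - 0)) subr0 add0r.
Qed.

Lemma open_unit (V : normedModType R) (P : set V) (B : V -> 'M[R]_n) : open P ->
  (forall u, P u -> differentiable B u) -> open (P `&` [set u | B u \in unitmx]).
Proof.
move=> oP dB; rewrite openE => u [Pu Bu]; apply: filterI.
  by apply: open_nbhs_nbhs.
exact: unitmx_near (dB u Pu) Bu.
Qed.

(** The base map is affine with linear part B and the matrix is [B + Q (u - coord c x)]. Away from
    [x] the two need not be related, so every linear [Q] occurs; the domain is where the matrix
    stays invertible. *)
Lemma jet_ex x y (xi : tiso A x y) c d (Q : {linear 'rV[R]_n -> 'M[R]_n}) :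
  dom c x -> dom d y -> exists eta : jet11 A x,
  [/\ jet_p eta = existT (tiso A x) y xi,
    forall h, 'd (bis_phi x c d (jet_rep eta)) (coord c x) h = h *m iso_mx xi c d &
    jet_dmx eta c d =1 Q].
Proof.
move=> cx dy; set B := iso_mx xi c d.
have uB : B \in unitmx by exact: iso_mx_unit.
pose phi u := coord d y + mulmxr B (u - coord c x).
pose psi v := coord c x + mulmxr (invmx B) (v - coord d y).
pose Bu u := B + Q (u - coord c x).
have Dphi u : is_diff u phi (mulmxr B) by exact: is_diff_affine.
have Dpsi v : is_diff v psi (mulmxr (invmx B)) by exact: is_diff_affine.
have DB u : is_diff u Bu Q by exact: is_diff_affine.
pose P := setT `&` [set u | Bu u \in unitmx].
have oP : open P.
  apply: open_unit => [|u _]; [exact: openT|exact: is_diff_differentiable (DB u)].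
have [||||||||||||||b [bx bxi bH]] := @bisection_ex _ _ _ _ HM x y xi c d phi psi Bu P setT.
- exact: cx.
- exact: dy.
- exact: oP.
- exact: openT.
- by split => //=; rewrite /Bu subrr linear0 addr0.
- by [].
- by rewrite /phi subrr linear0 addr0.
- by rewrite /Bu subrr linear0 addr0.
- move=> k; exact: (Ck_affine k oP Dphi).
- move=> k; exact: (Ck_affine k openT Dpsi).
- move=> k; exact: (Ck_affine k oP DB).
- by move=> u _; rewrite /psi /phi (addrC (coord d y)) addrK /= mulmxK// addrC subrK.
- by move=> u _; rewrite /psi /phi (addrC (coord c x)) addrK /= mulmxKV// addrC subrK.
- by move=> u [].
have [eta etaE] := jet_of_bisection bx.
have [pE H1 H2] := jet_rep_bisection etaE bx bxi cx dy.
have bH' x1 : bis_dom b x1 -> coord d (bis0 b x1) = phi (coord c x1) /\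
     iso_mx (tagged (b x1)) c d = Bu (coord c x1).
  by move=> /bH[].
have N := bis_coords_near bH' bx cx.
have N1 : \forall u \near coord c x, phi u = bis_phi x c d b u.
  by apply: filterS N => u [].
have N2 : \forall u \near coord c x, Bu u = bis_mx x c d b u.
  by apply: filterS N => u [].
exists eta; split=> [|h|h]; first exact: pE.
  exact: etrans (H1 h) (is_diffE (near_eq_is_diff N1 (Dphi _)) h).
exact: etrans (H2 h) (is_diffE (near_eq_is_diff N2 (DB _)) h).
Qed.

(** [affine_extensionP] prescribes the second-order part as an explicit linear form, which [jet_ex]
    realises; the default in [affine_ext] is thus never taken. *)
Lemma affine_extP (s : forall x, jet11 A x) (Hs : symmetry_jet s) x y (xi : tiso A x y) :
  affine_extension s xi (affine_ext s xi).
Proof.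
rewrite /affine_ext; case: xgetP => [//|H].
have [c cx] := chart_at HM x; have [d dy] := chart_at HM y.
set B := iso_mx xi c d in H *.
pose q (v : 'rV[R]_n) : 'M[R]_n :=
  2^-1 *: (B *m christoffel s d y (v *m B) - christoffel s c x v *m B).
have ql : linear q.
  move=> a v w; rewrite /q.
  have -> : (a *: v + w) *m B = a *: (v *m B) + w *m B by rewrite mulmxDl -scalemxAl.
  rewrite !christoffel_linear mulmxDr mulmxDl -scalemxAl -scalemxAr opprD.
  rewrite scalerA mulrC -scalerA -scalerDr scalerBr; congr (_ *: _).
  by rewrite addrACA.
pose Q : {linear 'rV[R]_n -> 'M[R]_n} := HB.pack q (GRing.isLinear.Build R _ _ _ _ ql).
have [eta [pE H1 H2]] := jet_ex xi Q cx dy.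
case: (H eta); apply/(affine_extensionP HM Hs xi eta cx dy).
split; [exact: pE|exact: H1|move=> v w].
apply: etrans (congr1 (mulmx w) (H2 v)) _.
by rewrite /= /q -scalemxAr mulmxBr !mulmxA.
Qed.

(** On second-order parts [kappa] exchanges the two arguments: the witness satisfies w Q'(v) = v
    Q(w). Semiholonomy makes the components seen by [p] and [p_*] agree after the swap. *)
Lemma jet_kappa_ex x y (xi : tiso A x y) (eta : jet11 A x) :
  semiholonomic eta -> jet_p eta = existT (tiso A x) y xi ->
  semiholonomic (jet_kappa eta) /\
  forall Z, t2_base Z = x ->
    jet_act (jet_kappa eta) Z = t2_kappa (jet_act eta (t2_kappa Z)).
Proof.
move=> sh pE; rewrite /jet_kappa; case: xgetP => [eta' _ //|H].
have [c cx] := chart_at HM x; have [d dy] := chart_at HM y.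
pose q (v : 'rV[R]_n) : 'M[R]_n := lin1_mx (fun w => v *m jet_dmx eta c d w).
have qE v w : w *m q v = v *m jet_dmx eta c d w.
  apply: mul_rV_lin1_fun => a u1 u2.
  have -> : jet_dmx eta c d (a *: u1 + u2) = a *: jet_dmx eta c d u1 + jet_dmx eta c d u2.
    exact: linearP.
  by rewrite mulmxDr -scalemxAr.
have ql : linear q.
  move=> a v w; apply/row_matrixP => i; rewrite !rowE mulmxDr -scalemxAr !qE.
  by rewrite mulmxDl -scalemxAl.
pose Q : {linear 'rV[R]_n -> 'M[R]_n} := HB.pack q (GRing.isLinear.Build R _ _ _ _ ql).
have [eta' [pE' H1 H2]] := jet_ex xi Q cx dy.
case: (H eta'); split; first exact: (semiholonomicP HM pE' cx dy).2 H1.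
move=> Z bZ.
have cZ : dom c (t2_base Z) by rewrite bZ.
have [bkZ /(_ c cZ) kZ] := t2_kappaP HM Z.
pose X := tagged (tag Z) c; pose a := (tagged Z c).1; pose V := (tagged Z c).2.
have ZE : t2coord c Z = ((coord c x, X), (a, V)).
  by rewrite t2coordE bZ -surjective_pairing.
rewrite ZE bZ /= in kZ.
have bkZx : t2_base (t2_kappa Z) = x by rewrite bkZ.
have [b1 E1] := jet_actE HM pE' cx dy bZ ZE.
have [b2 E2] := jet_actE HM pE cx dy bkZx kZ.
have [b3 E3] := t2_kappaP HM (jet_act eta (t2_kappa Z)).
have d2 : dom d (t2_base (jet_act eta (t2_kappa Z))) by rewrite b2.
have d1 : dom d (t2_base (jet_act eta' Z)) by rewrite b1.
apply: (t2coord_inj HM d1); first by rewrite b3.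
rewrite (E3 d d2) E1 E2 b2 /=.
have sh' := (semiholonomicP HM pE cx dy).1 sh.
have K1 := H1 a; have K2 := sh' X; have K3 := etrans (congr1 (mulmx X) (H2 a)) (qE a X).
exact: (congr2 pair (congr2 pair erefl (esym K2)) (congr2 pair K1 (congr2 +%R erefl K3))).
Qed.

End JetExistence.

(** * Semiholonomic jets that are 2-jets *)

Section Cayley.
Context {R : realType} {n : nat}.
Implicit Types (T : {linear 'rV[R]_n -> 'M[R]_n}) (h w : 'rV[R]_n).

Lemma linear_mx_ex (f : 'rV[R]_n -> 'M[R]_n) :
  linear f -> exists L : {linear 'rV[R]_n -> 'M[R]_n}, L =1 f.
Proof.
move=> fl.
pose L : {linear 'rV[R]_n -> 'M[R]_n} := HB.pack f (GRing.isLinear.Build R _ _ _ _ fl).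
by exists L.
Qed.

Definition symmetric_form (T : 'rV[R]_n -> 'M[R]_n) := forall v w, v *m T w = w *m T v.

(* For symmetric [T] this local diffeomorphism has the explicit inverse
   [cayley (- T)] and the second order expansion [h + h *m T h]: every 2-jet is
   thus realised without the inverse function theorem. *)
Definition cayley (T : 'rV[R]_n -> 'M[R]_n) h := h *m invmx (1%:M - T h).

(** With k = [cayley T h], the defining relation is k (1 - T h) = h. Symmetry replaces k T(h) by h
    T(k), which gives k = h (1 + T k). *)
Lemma cayleyK T h : symmetric_form T -> 1%:M - T h \in unitmx ->
  1%:M + T (cayley T h) \in unitmx ->
  cayley T h *m invmx (1%:M + T (cayley T h)) = h.
Proof.
move=> sT uT uT'; set k := cayley T h in uT' *.
have E : k *m (1%:M - T h) = h by rewrite mulmxKV.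
have {}E : h *m (1%:M + T k) = k.
  by rewrite mulmxDr mulmx1 (sT h k) -{1}E mulmxBr mulmx1 subrK.
by rewrite -{1}E mulmxK.
Qed.

(** The product rule gives (w + k T(w)) (1 - T h)^-1 with k = [cayley T h]; symmetry pulls w out on
    the left. The Jacobian is thus an explicit product, usable as the matrix of a bisection. *)
Lemma is_diff_cayley T h : symmetric_form T -> 1%:M - T h \in unitmx ->
  is_diff h (cayley T) (fun w => w *m ((1%:M + T (cayley T h)) *m invmx (1%:M - T h))).
Proof.
move=> sT uT.
have D1 : is_diff h (fun h => 1%:M - T h) (fun w => - T w).
  apply: (is_diff_fun (is_diffB (is_diff_cst (1%:M : 'M[R]_n) h) (linear_mx_is_diff T h))) => // w.
  by rewrite -[LHS]/(0 - T w) sub0r.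
have D := is_diff_mulmx (is_diff_id h) (is_diff_invmx D1 uT).
apply: (is_diff_fun D) => // w.
rewrite !mulmxN !mulNmx mulmxN opprK !mulmxA mulmxDr mulmx1 mulmxDl; congr (_ + _ *m _).
exact: sT.
Qed.

(** The first unit condition makes [cayley T] smooth, the second makes its inverse defined and its
    Jacobian invertible. The nested shape is that of [open_unit], applied twice. *)
Definition cayley_domain T (a : 'rV[R]_n -> 'rV[R]_n) :=
  (setT `&` [set u | 1%:M - T (a u) \in unitmx])
    `&` [set u | 1%:M + T (cayley T (a u)) \in unitmx].

Section Affine.
Variables (T : {linear 'rV[R]_n -> 'M[R]_n}) (a da : 'rV[R]_n -> 'rV[R]_n).
Hypotheses (sT : symmetric_form T) (Da : forall u, is_diff u a da).

Lemma is_diff_cayley_affine u : 1%:M - T (a u) \in unitmx ->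
  is_diff u (fun u => cayley T (a u))
    (fun w => da w *m ((1%:M + T (cayley T (a u))) *m invmx (1%:M - T (a u)))).
Proof. by move=> uT; exact: is_diff_comp_at (Da u) erefl (is_diff_cayley sT uT). Qed.

Lemma is_diff_one_sub u : is_diff u (fun u => 1%:M - T (a u)) (fun w => - T (da w)).
Proof.
have D := is_diff_comp_at (Da u) erefl (linear_mx_is_diff T (a u)).
apply: (is_diff_fun (is_diffB (is_diff_cst (1%:M : 'M[R]_n) u) D)) => // w.
by rewrite -[LHS]/(0 - T (da w)) sub0r.
Qed.

Lemma open_cayley_domain : open (cayley_domain T a).
Proof.
apply: open_unit => [|u [_ uT]].
  apply: open_unit => [|u _]; first exact: openT.
  exact: is_diff_differentiable (is_diff_one_sub u).
have D := is_diff_comp_at (is_diff_cayley_affine uT) erefl (linear_mx_is_diff T _).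
exact: is_diff_differentiable (is_diffD (is_diff_cst (1%:M : 'M[R]_n) u) D).
Qed.

Lemma Ck_cayley_invmx k : Ck k (cayley_domain T a) (fun u => invmx (1%:M - T (a u))).
Proof.
have oP := open_cayley_domain.
apply: Ck_invmx => // [j|u [[_ //]]].
exact: (Ck_affine j oP is_diff_one_sub).
Qed.

Lemma Ck_cayley k : Ck k (cayley_domain T a) (fun u => cayley T (a u)).
Proof.
have oP := open_cayley_domain.
exact: Ck_mulmx oP (Ck_affine k oP Da) (Ck_cayley_invmx k).
Qed.

End Affine.

End Cayley.

Section TwoJets.
Context {R : realType} {n : nat} {M : topologicalType} {A : charted 'rV[R]_n M}.
Hypothesis HM : smooth_manifold A.
Implicit Types (c d : chart A) (x y : M).
Let HA := manifold_atlas HM.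

Lemma sigT_eta (T : Type) (F : T -> Type) (z : {t : T & F t}) :
  z = existT F (tag z) (tagged z).
Proof. by case: z. Qed.

Lemma bis_2jetP (b : bisection A) x1 c d (v : tangent A x1) :
  bis_dom b x1 -> dom c x1 -> dom d (bis0 b x1) ->
  tagged (b x1) v = tdiff A A (bis0 b) v <->
  v c *m iso_mx (tagged (b x1)) c d = 'd (bis_phi x1 c d b) (coord c x1) (v c).
Proof.
move=> b1 c1 d1.
have T := tdiff_bis0 HM b1 (sigT_eta (b x1)) c1 d1 v (tagged (b x1) v).
rewrite -(iso_mxE HM _ _ _ c1); split=> [E|E]; last exact: existT_inj (T.2 E).
by apply: T.1; rewrite E.
Qed.

Lemma symmetric_2jet x y (xi : tiso A x y) (eta : jet11 A x) c d :
  jet_p eta = existT (tiso A x) y xi -> dom c x -> dom d y ->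
  (forall h, 'd (bis_phi x c d (jet_rep eta)) (coord c x) h = h *m iso_mx xi c d) ->
  symmetric_form (jet_dmx eta c d) -> is_2jet eta.
Proof.
move=> pE cx dy sh sym; set B := iso_mx xi c d in sh *.
have uB : B \in unitmx by exact: iso_mx_unit.
(* At the base point the differential of the matrix [Bu] below is 2 T(h) B, one T(h) from each of
   its two varying factors; it has to equal [jet_dmx eta c d h]. *)
pose t h := 2^-1 *: (jet_dmx eta c d h *m invmx B).
have tl : linear t.
  move=> a v w; rewrite /t.
  have -> : jet_dmx eta c d (a *: v + w) = a *: jet_dmx eta c d v + jet_dmx eta c d w.
    exact: linearP.
  by rewrite mulmxDl -scalemxAl scalerDr !scalerA mulrC.
have [T TE] := linear_mx_ex tl.
have ntl : linear (fun h => - T h) by move=> a v w; rewrite linearP opprD scalerN.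
have [NT NTE] := linear_mx_ex ntl.
have sT : symmetric_form T.
  by move=> v w; rewrite !TE /t -!scalemxAr !mulmxA (sym v w).
have sNT : symmetric_form NT by move=> v w; rewrite !NTE !mulmxN (sT v w).
(* Multiplication by [1%:M] and the summand 0 put [a] in the form of [is_diff_affine], parallel to
   [a']. *)
pose a u := 0 + mulmxr 1%:M (u - coord c x).
pose a' v := 0 + mulmxr (invmx B) (v - coord d y).
have Da u : is_diff u a (mulmxr 1%:M) by exact: is_diff_affine.
have Da' u : is_diff u a' (mulmxr (invmx B)) by exact: is_diff_affine.
have aE u : a u = u - coord c x by rewrite /a /= mulmx1 add0r.
have a'E v : a' v = (v - coord d y) *m invmx B by rewrite /a' add0r.
pose phi u := coord d y + cayley T (a u) *m B.
pose psi v := coord c x + cayley NT (a' v).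
(* By [is_diff_cayley] this is the Jacobian matrix of [phi] at every point of [P], so the bisection
   is holonomic on its whole domain and not only at [x]. *)
pose Bu u := ((1%:M + T (cayley T (a u))) *m invmx (1%:M - T (a u))) *m B.
pose P := cayley_domain T a; pose P' := cayley_domain NT a'.
have oP : open P by exact: open_cayley_domain sT Da.
have oP' : open P' by exact: open_cayley_domain sNT Da'.
have NTK h : 1%:M - NT h = 1%:M + T h by rewrite NTE opprK.
have NTK' h : 1%:M + NT h = 1%:M - T h by rewrite NTE.
have cay0 (S : {linear 'rV[R]_n -> 'M[R]_n}) : cayley S 0 = 0 by rewrite /cayley mul0mx.
have a0 : a (coord c x) = 0 by rewrite aE subrr.
have a'0 : a' (coord d y) = 0 by rewrite a'E subrr mul0mx.
have DcB u : P u -> is_diff u phi (fun w => w *m Bu u).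
  move=> [[_ uT] _].
  have D := is_diffD (is_diff_cst (coord d y) u)
    (is_diff_mulmx (is_diff_cayley_affine sT Da uT) (is_diff_cst B u)).
  apply: (is_diff_fun D) => // w.
  rewrite -[LHS]/(0 + ((w *m 1%:M) *m _ *m B + _ *m 0)).
  by rewrite mulmx0 addr0 add0r mulmx1; exact/esym/mulmxA.
have [||||||||||||||b [bx bxi bH]] := @bisection_ex _ _ _ _ HM x y xi c d phi psi Bu P P'.
- exact: cx.
- exact: dy.
- exact: oP.
- exact: oP'.
- by split; [split => //|]; rewrite /= a0 ?cay0 !linear0 ?subr0 ?addr0 unitmx1.
- by split; [split => //|]; rewrite /= a'0 ?cay0 !linear0 ?subr0 ?addr0 unitmx1.
- by rewrite /phi a0 cay0 mul0mx addr0.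
- by rewrite /Bu a0 cay0 !linear0 !addr0 invmx1 !mul1mx.
- move=> k; apply: (CkD oP (Ck_cst k _ oP)).
  exact: (Ck_mulmx oP (Ck_cayley sT Da k) (Ck_cst k _ oP)).
- move=> k; apply: (CkD oP' (Ck_cst k _ oP')).
  exact: (Ck_cayley sNT Da' k).
- move=> k; apply: (Ck_mulmx oP _ (Ck_cst k _ oP)).
  apply: (Ck_mulmx oP _ (Ck_cayley_invmx sT Da k)).
  apply: (CkD oP (Ck_cst k _ oP)).
  exact: (Ck_linear_mx T oP (Ck_cayley sT Da k)).
- move=> u [[_ u1] u2]; rewrite /psi a'E /phi (addrC (coord d y)) addrK mulmxK//.
  by rewrite [cayley NT _]/cayley NTK (cayleyK sT u1 u2) aE addrC subrK.
- move=> v [[_ u1] u2]; rewrite /phi aE /psi (addrC (coord c x)) addrK.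
  have K := cayleyK sNT u1 u2; rewrite NTK' in K.
  by rewrite [cayley T _]/cayley K a'E mulmxKV// addrC subrK.
- move=> u [[_ u1] u2]; rewrite /Bu unitmx_mul unitmx_mul unitmx_inv uB.
  by rewrite andbT; apply/andP; split.
have bH' x1 : bis_dom b x1 -> coord d (bis0 b x1) = phi (coord c x1) /\
     iso_mx (tagged (b x1)) c d = Bu (coord c x1).
  by move=> /bH[].
have Px : P (coord c x) by have [] := bH _ bx.
have N := bis_coords_near HM bH'.
exists b; split => //.
- apply: (jet_class_eq HM bx bxi pE cx dy) => h.
    have N1 : \forall u \near coord c x, phi u = bis_phi x c d b u.
      by apply: filterS (N _ bx cx) => u [].
    apply: etrans (is_diffE (near_eq_is_diff N1 (DcB _ Px)) h) _.
    by rewrite sh /Bu a0 cay0 !linear0 !addr0 invmx1 !mul1mx.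
  have N2 : \forall u \near coord c x, Bu u = bis_mx x c d b u.
    by apply: filterS (N _ bx cx) => u [].
  have [[_ u1] _] := Px.
  have D1 := is_diffD (is_diff_cst (1%:M : 'M[R]_n) (coord c x))
    (is_diff_comp_at (is_diff_cayley_affine sT Da u1) erefl (linear_mx_is_diff T _)).
  have D2 := is_diff_invmx (is_diff_one_sub T Da (coord c x)) u1.
  have D3 := is_diff_mulmx (is_diff_mulmx D1 D2) (is_diff_cst B (coord c x)).
  apply: etrans (is_diffE (near_eq_is_diff N2 D3) h) _.
  have TB : (T h + T h) *m B = jet_dmx eta c d h.
    rewrite TE -mulr2n /t -scaler_nat scalerA mulfV ?pnatr_eq0// scale1r.
    exact: mulmxKV.
  apply: etrans _ TB.
  rewrite -[LHS]/(((0 + T ((h *m 1%:M) *m _)) *m _ +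
     (1%:M + T (cayley T (a (coord c x)))) *m (- (_ *m (- T (h *m 1%:M)) *m _))) *m B + _ *m 0).
  rewrite a0 cay0 !linear0 !addr0 invmx1 add0r.
  by rewrite !mulmx1 !mul1mx opprK.
- move=> x1 bx1 v; have [c1 P1 d1 _ mE] := bH _ bx1.
  apply/(bis_2jetP v bx1 c1 d1); rewrite mE.
  have N1 : \forall u \near coord c x1, phi u = bis_phi x1 c d b u.
    by apply: filterS (N _ bx1 c1) => u [].
  exact: esym (is_diffE (near_eq_is_diff N1 (DcB _ P1)) (v c)).
Qed.

(** Near [x] the matrix of a holonomic bisection is the Jacobian of its base map, so its
    differential is a second derivative. The charts are those in which the base map is known to be
    smooth, since between charts only first-order differentiability of maps is transported. *)
Lemma symmetric_of_2jet x y (xi : tiso A x y) (eta : jet11 A x) :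
  jet_p eta = existT (tiso A x) y xi -> is_2jet eta ->
  exists c d, [/\ dom c x, dom d y & symmetric_form (jet_dmx eta c d)].
Proof.
move=> pE [b [bx etaE b2]]; have [rx rE] := jet_repP eta.
have bxi : b x = existT (tiso A x) y xi.
  have : j1 x (jet_rep eta) (jet_rep eta) by split.
  rewrite -rE etaE => -[_ [E _]].
  exact: etrans (existT_inj E) pE.
have [ob sb _ _] := bis_diffeo b.
have [c [d [cx dx Nd sF]]] := sb x bx.
have dy : dom d y by rewrite -(bis0E bxi).
exists c, d; split => // v w.
have [_ _ H2] := jet_rep_bisection HM etaE bx bxi cx dy.
set F := local_expr _ _ _ _ in sF.
have key k : \forall u \near coord c x, k *m bis_mx x c d b u = 'd F u k.
  have NF : \forall u \near coord c x,
      smooth_near F u /\ dom d (bis0 b (inv_coord c x u)).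
    by apply: filterS2 (smooth_near_near sF) Nd => u.
  apply: filterS3 (near_inv_coord_open HM x ob bx cx) (near_inv_coord HA x cx) NF.
  move=> u b1 [c1 uE] [sFu d1].
  have E := (bis_2jetP (tvec c _ k) b1 c1 d1).1 (b2 _ b1 _).
  rewrite (tvecE HM k c1) in E; apply: etrans E _.
  have dF : differentiable F (coord c (inv_coord c x u)).
    by rewrite uE; exact: smooth_near_differentiable.
  have N : \forall u' \near coord c (inv_coord c x u),
      F u' = bis_phi (inv_coord c x u) c d b u'.
    apply: filterS (near_inv_coord_default HA x (inv_coord c x u) c1) => u' iE.
    by rewrite /F /local_expr /bis_phi iE.
  have [_ dE] := near_eq_diff N dF.
  apply: etrans (congr1 (fun g => g k) dE) _; exact: diff_point.
have [_ /differentiableP Dm] := bis_local_differentiable HM bx bxi cx dy.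
have dE k h : 'd (fun u => 'd F u k) (coord c x) h = k *m 'd (bis_mx x c d b) (coord c x) h.
  have D := near_eq_is_diff (key k) (is_diff_mulmx (is_diff_cst k _) Dm).
  apply: etrans (is_diffE D h) _.
  by rewrite -[LHS]/(0 *m _ + _) mul0mx add0r.
have dF : \forall u \near coord c x, differentiable F u.
  by apply: filterS (smooth_near_near sF) => u; exact: smooth_near_differentiable.
have S := schwarz_mx v w dF
  (fun k => smooth_near_differentiable (smooth_near_diff k sF)).
apply: etrans (congr1 (mulmx v) (H2 w)) (etrans _ (congr1 (mulmx w) (esym (H2 v)))).
exact: (etrans (esym (dE v w)) (etrans S (dE w v))).
Qed.

End TwoJets.

(** Common source of both claims: the left side is the difference of the V components measured by
    [t2_pi], and its vanishing for all [v], [w] is the symmetry that characterises 2-jets. *)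
Lemma affine_ext_torsion (R : realType) (n : nat) (M : topologicalType)
    (A : charted 'rV[R]_n M) (HM : smooth_manifold A)
    (s : forall x : M, jet11 A x) (Hs : symmetry_jet s)
    (x y : M) (xi : tiso A x y) (c d : chart A) (v w : tangent A x) :
  dom c x -> dom d y ->
  w c *m jet_dmx (affine_ext s xi) c d (v c) - v c *m jet_dmx (affine_ext s xi) c d (w c) =
  (xi (torsion s v w) - torsion s (xi v) (xi w)) d.
Proof.
move=> cx dy.
have [_ _ H] := (affine_extensionP HM Hs xi _ cx dy).1 (affine_extP HM Hs xi).
have T1 := torsionE HM Hs (xi v) (xi w) dy.
have T2 := congr1 (mulmx^~ (iso_mx xi c d)) (torsionE HM Hs v w cx).
have T3 := etrans (iso_mxE HM xi d (torsion s v w) cx) T2.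
have Ev := iso_mxE HM xi d v cx; have Ew := iso_mxE HM xi d w cx.
rewrite Ev Ew in T1.
apply: etrans (congr2 (fun a b => a - b) (H (v c) (w c)) (H (w c) (v c))) _.
apply: etrans _ (esym (congr2 (fun a b => a - b) T3 T1)).
rewrite -scalemxAl mulmxBl -!scalerBr; congr (_ *: _).
have alg (p q r t : 'rV[R]_n) : p - q - (r - t) = t - q - (r - p).
  by apply/rowP => i; rewrite !mxE; ring.
exact: alg.
Qed.

Theorem proposition4p1 (R : realType) (n : nat) (M : topologicalType)
    (A : charted 'rV[R]_n M) (HM : smooth_manifold A)
    (s : forall x : M, jet11 A x) (Hs : symmetry_jet s)
    (x y : M) (xi : tiso A x y) :
  (forall (Z : {z : {x : M & tangent A x} & tangent (tangent_bundle A) z})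
          (X Y : tangent A x),
     t2_p Z = existT (tangent A) x Y ->
     t2_pstar Z = existT (tangent A) x X ->
     let Z1 := jet_act (affine_ext s xi) Z in
     let Z2 := jet_act (jet_kappa (affine_ext s xi)) Z in
     [/\ t2_p Z1 = t2_p Z2, t2_pstar Z1 = t2_pstar Z2 &
         t2_pi Z1 Z2 =
         existT (tangent A) y (xi (torsion s X Y) - torsion s (xi X) (xi Y))])
  /\ (is_2jet (affine_ext s xi) <-> preserves_torsion s xi).
Proof.
have [sh pE _] := affine_extP HM Hs xi.
set eta := affine_ext s xi in sh pE *.
split=> [Z X Y pZ psZ Z1 Z2|].
  have [c cx] := chart_at HM x; have [d dy] := chart_at HM y.
  have bZ : t2_base Z = x by exact: (congr1 (fun z : {x : M & tangent A x} => tag z) pZ).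
  have cZ : dom c (t2_base Z) by rewrite bZ.
  have sh' := (semiholonomicP HM pE cx dy).1 sh.
  have YE : tagged (tag Z) c = Y c.
    exact: (congr1 (fun z : {x : M & tangent A x} => tagged z c) pZ).
  have XE : (tagged Z c).1 = X c.
    have := t2_pstarE HM cZ; rewrite psZ; exact: esym.
  pose V := (tagged Z c).2.
  have ZE : t2coord c Z = ((coord c x, Y c), (X c, V)).
    by rewrite t2coordE bZ YE -XE -surjective_pairing.
  have [b1 E1] := jet_actE HM pE cx dy bZ ZE.
  (* The action of [jet_kappa eta] is that of [eta] conjugated by [t2_kappa], so it is computed by
     letting [eta] act on the swapped point; this exchanges X and Y in the second-order term. *)
  have [_ kact] := jet_kappa_ex HM sh pE.
  have [bkZ /(_ c cZ) kZ] := t2_kappaP HM Z.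
  rewrite ZE bZ /= in kZ.
  have bkZx : t2_base (t2_kappa Z) = x by rewrite bkZ.
  have [b2 E2] := jet_actE HM pE cx dy bkZx kZ.
  have [b3 E3] := t2_kappaP HM (jet_act eta (t2_kappa Z)).
  have d2 : dom d (t2_base (jet_act eta (t2_kappa Z))) by rewrite b2.
  have {}E3 := E3 d d2; rewrite -(kact Z bZ) -/Z2 E2 b2 /= in b3 E3.
  rewrite -/Z1 in b1 E1.
  have F1 := sh' (X c); have F2 := sh' (Y c).
  have G1 : tagged (tag Z1) d = Y c *m iso_mx xi c d.
    exact: (congr1 (fun q => q.1.2) E1).
  have G2 : tagged (tag Z2) d = Y c *m iso_mx xi c d.
    exact: etrans (congr1 (fun q => q.1.2) E3) F2.
  have P1 : (t2coord d Z1).2.1 = X c *m iso_mx xi c d.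
    exact: etrans (congr1 (fun q => q.2.1) E1) F1.
  have P2 : (t2coord d Z2).2.1 = X c *m iso_mx xi c d.
    exact: (congr1 (fun q => q.2.1) E3).
  have d1 : dom d (t2_base Z1) by rewrite b1.
  have d3 : dom d (t2_base Z2) by rewrite b3.
  have bE : t2_base Z1 = t2_base Z2 by exact: (etrans b1 (esym b3)).
  have pE12 : t2_p Z1 = t2_p Z2.
    apply: (tangent_bundle_inj HM d1 d3); last exact: (etrans G1 (esym G2)).
    exact: (congr1 (coord d) bE).
  split; first exact: pE12.
    apply: (@tangent_bundle_inj _ _ _ _ HM d (t2_pstar Z1) (t2_pstar Z2) d1 d3).
      exact: (congr1 (coord d) bE).
    exact: (etrans (t2_pstarE HM d1) (etrans P1 (esym (etrans (t2_pstarE HM d3) P2)))).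
  set t := xi _ - _.
  (* [t2_pi] takes its value over [t2_base Z1], which equals [y] only propositionally, so [t] is
     first moved to that fibre. *)
  have [w wE] : exists w : tangent A (t2_base Z1),
      existT (tangent A) _ w = existT (tangent A) y t.
    by rewrite b1; exists t.
  rewrite -wE; apply: (t2_piE HM d1 pE12); first exact: (etrans P1 (esym P2)).
  have -> : w d = t d by exact: (congr1 (fun z : {x : M & tangent A x} => tagged z d) wE).
  rewrite -(affine_ext_torsion HM Hs xi X Y cx dy).
  have V1 := congr1 (fun q => q.2.2) E1; have V2 := congr1 (fun q => q.2.2) E3.
  apply: etrans _ (esym (congr2 (fun a b => a - b) V1 V2)).
  have alg (p q r : 'rV[R]_n) : q - r = (p + q) - (p + r).
    by rewrite opprD addrACA subrr add0r.
  exact: alg.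
split=> [j2 v w|pres].
  have [c [d [cx dy sym]]] := symmetric_of_2jet HM pE j2.
  have K := affine_ext_torsion HM Hs xi v w cx dy.
  apply/eqP; rewrite -subr_eq0 -oppr_eq0 opprB; apply/eqP/(tangent_at_inj dy).
  apply: etrans (esym K) _; apply/eqP; rewrite subr_eq0; apply/eqP; exact: sym.
have [c cx] := chart_at HM x; have [d dy] := chart_at HM y.
apply: (symmetric_2jet HM pE cx dy ((semiholonomicP HM pE cx dy).1 sh)) => a b.
have K := affine_ext_torsion HM Hs xi (tvec c x b) (tvec c x a) cx dy.
rewrite pres subrr !(tvecE HM _ cx) in K.
by apply/eqP; rewrite -subr_eq0; apply/eqP; exact: K.
Qed.
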